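(* Consider the rotator-pendulum Hamiltonian $H_0(p,q,I,\theta)=h_0(I)+\sum_{i=1}^n\pm\left(\tfrac12p_i^2+V_i(q_i)\right)$, its general time-dependent (not necessarily Hamiltonian) perturbation $\dot z=\mathcal X^0(z)+\varepsilon\mathcal X^1(z,t;\varepsilon)$ with $\mathcal X^0=J\nabla H_0$, and the associated extended flow $\tilde\Phi^s_\varepsilon$, normally hyperbolic manifolds $\tilde\Lambda_\varepsilon$ and foot-point projections $\Omega^\pm$, as set up in the context. Assume that $W^{\rm s}(\tilde\Lambda_\varepsilon)$ and $W^{\rm u}(\tilde\Lambda_\varepsilon)$ intersect transversally for $0<|\varepsilon|<\varepsilon_0$ along homoclinic channels depending smoothly on $\varepsilon$, and let $\tilde z_\varepsilon\in W^{\rm s}(\tilde\Lambda_\varepsilon)\cap W^{\rm u}(\tilde\Lambda_\varepsilon)$ be homoclinic points in these channels, with $\tilde z_\varepsilon^\pm=\Omega^\pm(\tilde z_\varepsilon)\in\tilde\Lambda_\varepsilon$, so that the scattering map satisfies $\tilde\sigma_\varepsilon(\tilde z_\varepsilon^-)=\tilde z_\varepsilon^+$. Let $\tilde z_0\in W^{\rm s}(\tilde\Lambda_0)\cap W^{\rm u}(\tilde\Lambda_0)$ be the homoclinic point of the unperturbed system corresponding to $\tilde z_\varepsilon$, i.e. $\tilde z_\varepsilon=\tilde z_0+O(\varepsilon)$, and let $\tilde z_0^\pm=\Omega^\pm(\tilde z_0)\in\tilde\Lambda_0$; here $\tilde z_0^+=\tilde z_0^-$, and this common point is denoted $\tilde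 z_0^\pm$. Then there is $0<\varrho<1$ such that the change in action $I$ by the scattering map $\tilde\sigma_\varepsilon$ is given by $$I(\tilde z_\varepsilon^+)-I(\tilde z_\varepsilon^-)=-\varepsilon\int_{-\infty}^{+\infty}\left(\mathcal X^1I(\tilde\Phi_0^s(\tilde z_0^\pm))-\mathcal X^1I(\tilde\Phi_0^s(\tilde z_0))\right)ds+O(\varepsilon^{1+\varrho}).$$ In the case when the perturbation is Hamiltonian, $\mathcal X^1=J\nabla_zH_1$ with $H_1=H_1(z,t;\varepsilon)$, this reads $$I(\tilde z_\varepsilon^+)-I(\tilde z_\varepsilon^-)=-\varepsilon\int_{-\infty}^{+\infty}\left([I,H_1](\tilde\Phi_0^s(\tilde z_0^\pm))-[I,H_1](\tilde\Phi_0^s(\tilde z_0))\right)ds+O(\varepsilon^{1+\varrho}).$$ The integrals on the right-hand sides are evaluated with $\mathcal X^1=\mathcal X^1(\cdot;0)$ and $H_1=H_1(\cdot;0)$, respectively.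
   Context: **Unperturbed system.** $z=(p,q,I,\theta)$ with $p\in\mathbb R^n$, $q\in\mathbb T^n$, $I\in\mathbb R^d$, $\theta\in\mathbb T^d$ ($\mathbb T=\mathbb R/\mathbb Z$), symplectic form $\sum_i dp_i\wedge dq_i+\sum_j dI_j\wedge d\theta_j$, phase space $M$. $H_0(p,q,I,\theta)=h_0(I)+\sum_{i=1}^n\pm(\frac12p_i^2+V_i(q_i))$ is $C^{r+1}$ with $r$ sufficiently large, where for each $i$ a sign $\pm$ is fixed. Each $V_i$ is $1$-periodic, $V_i'(0)=0$, $V_i''(0)<0$ (a local maximum), and $V_i'(q_* )=0$, $V_i(q_* )=V_i(0)$ imply $q_*=0$. Sign conventions: the Hamiltonian vector field $J\nabla H$ is $\dot p=-\partial_qH$, $\dot q=\partial_pH$, $\dot I=-\partial_\theta H$, $\dot\theta=\partial_IH$; thus $[I,H]=-\partial H/\partial\theta$ and $[\theta,H]=\partial H/\partial I$. Write $\omega(I)=\partial h_0/\partial I$. **Perturbation.** $\mathcal X^1(z,t;\varepsilon)$ is a time- and parameter-dependent $C^r$ vector field on $M$, uniformly differentiable in all variables (bounded with bounded derivatives), with arbitrary dependence on $t\in\mathbb R$; in the Hamiltonian case $H_1$ is $C^{r+1}$. A vector field acts on functions as a differential operator, $\mathcal X f=\sum_j\mathcal X_j\,\partial_{z_j}f$, componentwise on vector-valued $f$; so $\mathcal X^1I$ is the $I$-component of $\mathcal X^1$. **Extended flow.** $\tilde\Phi^s_\varepsilon$ is the flow on $\tilde M=M\times\mathbb R$ of $\dot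 z=\mathcal X^0(z)+\varepsilon\mathcal X^1(z,t;\varepsilon)$, $\dot t=1$ (derivatives in $s$); $\tilde z=(z,t)$; functions of $z$ are viewed as functions on $\tilde M$. **NHIMs.** Let $D\subset\mathbb R^d$ be a closed ball, $\Lambda_0=\{p=q=0,\ I\in D\}$ and $\tilde\Lambda_0=\Lambda_0\times\mathbb R$, a normally hyperbolic invariant manifold (NHIM) with boundary of $\tilde\Phi^s_0$. For it $W^{\rm s}(\tilde\Lambda_0)=W^{\rm u}(\tilde\Lambda_0)$, and $W^{\rm s}(\tilde z)=W^{\rm u}(\tilde z)$ for each $\tilde z\in\tilde\Lambda_0$. For $|\varepsilon|<\varepsilon_0$ it persists as a (locally invariant; invariant for a suitably extended system) NHIM $\tilde\Lambda_\varepsilon$ of $\tilde\Phi_\varepsilon^s$; $\tilde\Lambda_\varepsilon$, its stable and unstable manifolds $W^{\rm s}(\tilde\Lambda_\varepsilon)$, $W^{\rm u}(\tilde\Lambda_\varepsilon)$, and their fibers $W^{\rm s}(\tilde z),W^{\rm u}(\tilde z)$, $\tilde z\in\tilde\Lambda_\varepsilon$, depend smoothly on $\varepsilon$ (and are $O(\varepsilon)$-close to the unperturbed ones). **Foot points.** $\Omega^+:W^{\rm s}(\tilde\Lambda_\varepsilon)\to\tilde\Lambda_\varepsilon$, $\Omega^-:W^{\rm u}(\tilde\Lambda_\varepsilon)\to\tilde\Lambda_\varepsilon$ are the projections along fibers: $\tilde z\in W^{\rm s}(\Omega^+(\tilde z))$, $\tilde z\in W^{\rm u}(\Omega^-(\tilde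 z))$. They are characterized by $d(\tilde\Phi^s_\varepsilon(\tilde z),\tilde\Phi^s_\varepsilon(\Omega^+\tilde z))\le Ce^{s\lambda_+}$ for $s\ge0$ and $d(\tilde\Phi^s_\varepsilon(\tilde z),\tilde\Phi^s_\varepsilon(\Omega^-\tilde z))\le Ce^{s\mu_-}$ for $s\le0$, with $\lambda_+<0<\mu_-$ and $C$ independent of $\varepsilon$. **Scattering map.** A homoclinic channel is a manifold $\tilde\Gamma_\varepsilon\subset W^{\rm s}(\tilde\Lambda_\varepsilon)\cap W^{\rm u}(\tilde\Lambda_\varepsilon)$ along which the intersection is transverse, with $T\tilde M=T\tilde\Gamma_\varepsilon\oplus TW^{\rm u}(\tilde z^-)\oplus TW^{\rm s}(\tilde z^+)$ at every $\tilde z\in\tilde\Gamma_\varepsilon$ ($\tilde z^\pm=\Omega^\pm(\tilde z)$), such that $\Omega^\pm|_{\tilde\Gamma_\varepsilon}$ are diffeomorphisms onto open subsets of $\tilde\Lambda_\varepsilon$. The scattering map is $\tilde\sigma_\varepsilon=\Omega^+\circ(\Omega^-|_{\tilde\Gamma_\varepsilon})^{-1}$. For $\varepsilon=0$ the scattering map is the identity, $\tilde z_0^-=\tilde z_0^+$. $O(\varepsilon^{a})$ denotes a quantity bounded by a constant times $|\varepsilon|^{a}$ as $\varepsilon\to0$. *)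

(* Defs.v *)
From HB Require Import structures.
From mathcomp Require Export all_boot all_order all_algebra.
From mathcomp Require Export all_classical all_reals all_analysis.

Set Implicit Arguments.
Unset Strict Implicit.
Unset Printing Implicit Defensive.

Export Order.TTheory GRing.Theory Num.Theory.
Export numFieldNormedType.Exports.

Local Open Scope classical_set_scope.
Local Open Scope ring_scope.

(* M = R^n x T^n x R^d x T^d is handled through its universal cover: points are
   written ((p, q), (I, theta)) with q and theta real, functions and sets on M
   are lattice-periodic functions and lattice-invariant sets on the cover, and
   equality and distance in M are [eqM] and [distM].  Angles have period 1.
   Extended phase points are pairs (z, t). *)

Notation phase R n d := ('rV[R]_n * 'rV[R]_n * ('rV[R]_d * 'rV[R]_d))%type.
Notation ext_phase R n d := (phase R n d * R)%type.
(* (I, theta, t), the coordinates on the unperturbed cylinder *)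
Notation base R d := ('rV[R]_d * 'rV[R]_d * R)%type.

Definition mom (R : realType) (n d : nat) (z : phase R n d) : 'rV[R]_n := z.1.1.
Definition pos (R : realType) (n d : nat) (z : phase R n d) : 'rV[R]_n := z.1.2.
Definition act (R : realType) (n d : nat) (z : phase R n d) : 'rV[R]_d := z.2.1.
Definition ang (R : realType) (n d : nat) (z : phase R n d) : 'rV[R]_d := z.2.2.

Definition e_mom (R : realType) (n d : nat) (i : 'I_n) : phase R n d :=
  ((delta_mx 0 i, 0), (0, 0)).
Definition e_pos (R : realType) (n d : nat) (i : 'I_n) : phase R n d :=
  ((0, delta_mx 0 i), (0, 0)).
Definition e_act (R : realType) (n d : nat) (j : 'I_d) : phase R n d :=
  ((0, 0), (delta_mx 0 j, 0)).
Definition e_ang (R : realType) (n d : nat) (j : 'I_d) : phase R n d :=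
  ((0, 0), (0, delta_mx 0 j)).

Definition int_vec (R : realType) (m : nat) (v : 'rV[R]_m) : Prop :=
  forall i, v 0 i \is a Num.int.

Definition lattice (R : realType) (n d : nat) : set (phase R n d) :=
  [set l | [/\ mom l = 0, act l = 0, int_vec (pos l) & int_vec (ang l)]].

Definition ext_lattice (R : realType) (n d : nat) : set (ext_phase R n d) :=
  [set l | lattice l.1 /\ l.2 = 0].

Definition periodic_on_M (R : realType) (n d : nat) (T : Type)
    (f : phase R n d -> T) : Prop :=
  forall z l, lattice l -> f (z + l) = f z.

Definition eqM (R : realType) (n d : nat) (x y : ext_phase R n d) : Prop :=
  ext_lattice (x - y).

Definition distM (R : realType) (n d : nat) (x y : ext_phase R n d) : R :=
  inf [set `|x - y - l| | l in @ext_lattice R n d].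

(* On an open subset of a finite-dimensional space, f is C^(k+1) iff it is
   differentiable and all its directional derivatives are C^k. *)
Fixpoint Ck (R : realType) (V W : normedModType R) (k : nat) (U : set V)
    (f : V -> W) : Prop :=
  if k is k'.+1 then
    (forall x, U x -> differentiable f x) /\
    (forall v, Ck k' U (fun x => 'D_v f x))
  else forall x, U x -> {for x, continuous f}.

Definition bounded_on (R : realType) (V W : normedModType R) (U : set V)
    (f : V -> W) : Prop :=
  exists B : R, forall x, U x -> `|f x| <= B.

Fixpoint Ckb (R : realType) (V W : normedModType R) (k : nat) (U : set V)
    (f : V -> W) : Prop :=
  bounded_on U f /\
  (if k is k'.+1 then
     (forall x, U x -> differentiable f x) /\
     (forall v, Ckb k' U (fun x => 'D_v f x))
   else forall x, U x -> {for x, continuous f}).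

(* f is C^k on an arbitrary subset S: it extends locally to a C^k function *)
Definition Ck_on_subset (R : realType) (V W : normedModType R) (k : nat)
    (S : set V) (f : V -> W) : Prop :=
  forall x, S x -> exists U F,
    [/\ open U, U x, Ck k U F & forall y, U y -> S y -> F y = f y].

Definition rotator_pendulum (R : realType) (n d : nat) (h0 : 'rV[R]_d -> R)
    (sg : 'I_n -> bool) (V : 'I_n -> R -> R) (z : phase R n d) : R :=
  h0 (act z) +
  \sum_(i < n) (-1) ^+ sg i * (mom z 0 i ^+ 2 / 2 + V i (pos z 0 i)).

Definition pendulum_potential (R : realType) (V : R -> R) : Prop :=
  [/\ forall x, V (x + 1) = V x,
      derive1 V 0 = 0,
      derive1 (derive1 V) 0 < 0 &
      forall x, derive1 V x = 0 -> V x = V 0 -> x \is a Num.int].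

(* J grad H *)
Definition ham_field (R : realType) (n d : nat) (H : phase R n d -> R)
    (z : phase R n d) : phase R n d :=
  ((\row_i - 'D_(@e_pos R n d i) H z, \row_i 'D_(@e_mom R n d i) H z),
   (\row_j - 'D_(@e_ang R n d j) H z, \row_j 'D_(@e_act R n d j) H z)).

(* [f, g], with [I, H] = - dH/dtheta and [theta, H] = dH/dI *)
Definition poisson (R : realType) (n d : nat) (f g : phase R n d -> R)
    (z : phase R n d) : R :=
  \sum_(i < n) ('D_(@e_pos R n d i) f z * 'D_(@e_mom R n d i) g z
                - 'D_(@e_mom R n d i) f z * 'D_(@e_pos R n d i) g z)
  + \sum_(j < d) ('D_(@e_ang R n d j) f z * 'D_(@e_act R n d j) g z
                - 'D_(@e_act R n d j) f z * 'D_(@e_ang R n d j) g z).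

Definition vpoisson (R : realType) (n d m : nat) (f : phase R n d -> 'rV[R]_m)
    (g : phase R n d -> R) (z : phase R n d) : 'rV[R]_m :=
  \row_j poisson (fun y => f y 0 j) g z.

(* X f = sum_j X_j df/dz_j *)
Definition lie (R : realType) (n d m : nat) (X : phase R n d -> phase R n d)
    (f : phase R n d -> 'rV[R]_m) (z : phase R n d) : 'rV[R]_m :=
  \sum_(i < n) (mom (X z) 0 i *: 'D_(@e_mom R n d i) f z
                + pos (X z) 0 i *: 'D_(@e_pos R n d i) f z)
  + \sum_(j < d) (act (X z) 0 j *: 'D_(@e_act R n d j) f z
                + ang (X z) 0 j *: 'D_(@e_ang R n d j) f z).

(* dz/ds = X0(z) + eps X1(z, t; eps), dt/ds = 1 *)
Definition ext_field (R : realType) (n d : nat)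
    (X0 : phase R n d -> phase R n d)
    (X1 : phase R n d -> R -> R -> phase R n d) (eps : R)
    (w : ext_phase R n d) : ext_phase R n d :=
  (X0 w.1 + eps *: X1 w.1 w.2 eps, 1).

Definition is_flow (R : realType) (V : normedModType R) (X : V -> V)
    (Phi : R -> V -> V) : Prop :=
  forall x, Phi 0 x = x /\
    forall s, is_derive s (1 : R) (fun u => Phi u x) (X (Phi s x)).

Definition Ws (R : realType) (n d : nat)
    (Phi : R -> ext_phase R n d -> ext_phase R n d) (lam_p : R)
    (y : ext_phase R n d) : set (ext_phase R n d) :=
  [set x | exists C : R, forall s, 0 <= s ->
     distM (Phi s x) (Phi s y) <= C * expR (s * lam_p)].

Definition Wu (R : realType) (n d : nat)
    (Phi : R -> ext_phase R n d -> ext_phase R n d) (mu_m : R)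
    (y : ext_phase R n d) : set (ext_phase R n d) :=
  [set x | exists C : R, forall s, s <= 0 ->
     distM (Phi s x) (Phi s y) <= C * expR (s * mu_m)].

Definition WsL (R : realType) (n d : nat)
    (Phi : R -> ext_phase R n d -> ext_phase R n d) (lam_p : R)
    (L : set (ext_phase R n d)) : set (ext_phase R n d) :=
  [set x | exists2 y, L y & Ws Phi lam_p y x].

Definition WuL (R : realType) (n d : nat)
    (Phi : R -> ext_phase R n d -> ext_phase R n d) (mu_m : R)
    (L : set (ext_phase R n d)) : set (ext_phase R n d) :=
  [set x | exists2 y, L y & Wu Phi mu_m y x].

Definition orbit_in (R : realType) (V : Type) (Phi : R -> V -> V) (L : set V)
    (x : V) (s : R) : Prop :=
  forall u, 0 <= u <= 1 -> L (Phi (u * s) x).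

(* L is locally invariant (orbits starting in its interior part Lint stay in L
   for a short time), and T V = TL + Es + Eu along L with Es, Eu invariant,
   rates lam_p < - mu_c < 0 < mu_c < mu_m, as long as the orbit remains in L. *)
Definition normally_hyperbolic (R : realType) (n d : nat)
    (Phi : R -> ext_phase R n d -> ext_phase R n d)
    (L Lint : set (ext_phase R n d))
    (TL Es Eu : ext_phase R n d -> {vspace (ext_phase R n d)})
    (lam_p mu_c mu_m : R) : Prop :=
  [/\ [/\ lam_p < - mu_c, 0 < mu_c & mu_c < mu_m],
      forall x, Lint x -> \forall s \near (0 : R), L (Phi s x),
      forall x, L x -> (TL x + Es x + Eu x = fullv)%VS /\
                       directv (TL x + Es x + Eu x)%VS,
      forall x s, L x -> orbit_in Phi L x s ->
        (linfun ('d (Phi s) x) @: Es x = Es (Phi s x))%VS /\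
        (linfun ('d (Phi s) x) @: Eu x = Eu (Phi s x))%VS &
      exists C : R, forall x s v, L x -> orbit_in Phi L x s ->
        [/\ v \in TL x ->
              `|'d (Phi s) x v| <= C * expR (mu_c * `|s|) * `|v|,
            0 <= s -> v \in Es x ->
              `|'d (Phi s) x v| <= C * expR (lam_p * s) * `|v| &
            s <= 0 -> v \in Eu x ->
              `|'d (Phi s) x v| <= C * expR (mu_m * s) * `|v| ] ].

Definition closed_eball (R : realType) (d : nat) (c : 'rV[R]_d) (rad : R) :
    set 'rV[R]_d :=
  [set I | \sum_(j < d) (I 0 j - c 0 j) ^+ 2 <= rad ^+ 2].

(* Smooth family of cylinders: emb eps parametrizes the manifold at eps by
   (I, theta, t), chart eps inverts it, and sfib eps b, ufib eps b parametrize
   local stable and unstable fibers over emb eps b by the unit ball of R^n.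
   Only the values for I in D matter; emb, sfib, ufib are assumed to be extended
   smoothly to all I, so that tangent spaces at the boundary make sense. *)
Record cylinders (R : realType) (n d : nat) := Cylinders {
  emb : R -> base R d -> ext_phase R n d;
  chart : R -> ext_phase R n d -> base R d;
  sfib : R -> base R d -> 'rV[R]_n -> ext_phase R n d;
  ufib : R -> base R d -> 'rV[R]_n -> ext_phase R n d }.

Definition Lam (R : realType) (n d : nat) (N : cylinders R n d)
    (D : set 'rV[R]_d) (eps : R) : set (ext_phase R n d) :=
  [set w | exists2 b : base R d, D b.1.1 & eqM w (emb N eps b)].

Definition TLam (R : realType) (n d : nat) (N : cylinders R n d) (eps : R)
    (w : ext_phase R n d) : {vspace (ext_phase R n d)} :=
  limg (linfun ('d (emb N eps) (chart N eps w))).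
Definition Es (R : realType) (n d : nat) (N : cylinders R n d) (eps : R)
    (w : ext_phase R n d) : {vspace (ext_phase R n d)} :=
  limg (linfun ('d (sfib N eps (chart N eps w)) 0)).
Definition Eu (R : realType) (n d : nat) (N : cylinders R n d) (eps : R)
    (w : ext_phase R n d) : {vspace (ext_phase R n d)} :=
  limg (linfun ('d (ufib N eps (chart N eps w)) 0)).

Definition theta_equivariant (R : realType) (n d : nat)
    (f : base R d -> ext_phase R n d) : Prop :=
  forall b m, int_vec m ->
    f (b.1.1, b.1.2 + m, b.2) = f b + (((0, 0), (0, m)), 0).

(* f eps b parametrizes a family of local fibers W(emb eps b), C^ell jointly
   with eps, and O(eps)-close to the family at eps = 0 *)
Definition fiber_family (R : realType) (n d : nat) (ell : nat) (eps0 : R)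
    (D : set 'rV[R]_d) (e : R -> base R d -> ext_phase R n d)
    (W : R -> ext_phase R n d -> set (ext_phase R n d))
    (f : R -> base R d -> 'rV[R]_n -> ext_phase R n d) : Prop :=
  [/\ Ck ell [set w : R * base R d * 'rV[R]_n | `|w.1.1| < eps0 /\ `|w.2| < 1]
        (fun w => f w.1.1 w.1.2 w.2),
      forall eps, `|eps| < eps0 -> forall a, `|a| < 1 ->
        theta_equivariant (fun b => f eps b a),
      forall eps b, `|eps| < eps0 -> D b.1.1 ->
        [/\ f eps b 0 = e eps b,
            forall a, `|a| < 1 -> W eps (e eps b) (f eps b a),
            forall a a', `|a| < 1 -> `|a'| < 1 ->
              eqM (f eps b a) (f eps b a') -> a = a' &
            \dim (limg (linfun ('d (f eps b) 0))) = n] &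
      exists K : R, forall eps b a, `|eps| < eps0 -> D b.1.1 -> `|a| < 1 ->
        `|f eps b a - f 0 b a| <= K * `|eps|].

(* The unperturbed cylinder {p = q = 0, I in D} persists, for |eps| < eps0, as a
   normally hyperbolic manifold with boundary that is C^ell in eps, and so do
   its fibers. *)
Definition persistent_nhim (R : realType) (n d : nat) (ell : nat) (eps0 : R)
    (D : set 'rV[R]_d) (lam_p mu_c mu_m : R)
    (Phi : R -> R -> ext_phase R n d -> ext_phase R n d)
    (N : cylinders R n d) : Prop :=
  [/\ forall b : base R d, emb N 0 b = (((0, 0), (b.1.1, b.1.2)), b.2),
      [/\ Ck ell [set w : R * base R d | `|w.1| < eps0]
            (fun w => emb N w.1 w.2),
          (forall eps, `|eps| < eps0 -> theta_equivariant (emb N eps)) &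
          exists K : R, forall eps b, `|eps| < eps0 -> D b.1.1 ->
            `|emb N eps b - emb N 0 b| <= K * `|eps|],
      forall eps, `|eps| < eps0 ->
        Ck_on_subset ell (Lam N D eps) (chart N eps) /\
        (forall b l, D b.1.1 -> ext_lattice l ->
           chart N eps (emb N eps b + l) = (b.1.1, b.1.2 + ang l.1, b.2)),
      forall eps, `|eps| < eps0 ->
        normally_hyperbolic (Phi eps) (Lam N D eps) (Lam N (D°) eps)
          (TLam N eps) (Es N eps) (Eu N eps) lam_p mu_c mu_m &
      fiber_family ell eps0 D (emb N) (fun eps => Ws (Phi eps) lam_p) (sfib N)
      /\ fiber_family ell eps0 D (emb N) (fun eps => Wu (Phi eps) mu_m) (ufib N)].

(* Om is the projection of the union of the W y, y in L, along the fibers W y;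
   lifted to the cover, it commutes with the deck transformations. *)
Definition foot_projection (R : realType) (n d : nat)
    (L : set (ext_phase R n d))
    (W : ext_phase R n d -> set (ext_phase R n d))
    (Om : ext_phase R n d -> ext_phase R n d) : Prop :=
  forall x, (exists2 y, L y & W y x) ->
    [/\ L (Om x), W (Om x) x & forall l, ext_lattice l -> Om (x + l) = Om x + l].

(* T is the tangent space at x of the (possibly only immersed) m-dimensional
   manifold S: S contains a C^1 disk through x with tangent space T. *)
Definition tangent_space (R : realType) (n d m : nat)
    (S : set (ext_phase R n d)) (x : ext_phase R n d)
    (T : {vspace (ext_phase R n d)}) : Prop :=
  exists (U : set 'rV[R]_m) (g : 'rV[R]_m -> ext_phase R n d),
    [/\ open U, U 0, Ck 1 U g, forall u, U u -> S (g u) &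
        [/\ g 0 = x, T = limg (linfun ('d g 0)) & \dim T = m] ].

(* For eps in A, G eps is an embedded C^ell submanifold of dimension m,
   and these submanifolds depend on eps in a C^ell way. *)
Definition smooth_family (R : realType) (n d ell m : nat) (A : set R)
    (G : R -> set (ext_phase R n d)) : Prop :=
  forall e1 x1, A e1 -> G e1 x1 ->
  exists (U : set (R * 'rV[R]_m)) (W : set (R * ext_phase R n d))
         (g : R * 'rV[R]_m -> ext_phase R n d)
         (c : R * ext_phase R n d -> 'rV[R]_m),
    [/\ [/\ open U, open W & W (e1, x1)], Ck ell U g, Ck ell W c,
        forall e u, A e -> U (e, u) ->
          [/\ G e (g (e, u)), W (e, g (e, u)) & c (e, g (e, u)) = u] &
        forall e x, A e -> W (e, x) -> G e x ->
          U (e, c (e, x)) /\ g (e, c (e, x)) = x].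

Definition diffeo_onto_open (R : realType) (V : normedModType R) (ell : nat)
    (S L : set V) (f : V -> V) : Prop :=
  [/\ Ck_on_subset ell S f,
      exists2 O, open O & f @` S = L `&` O &
      exists2 g : V -> V, Ck_on_subset ell (f @` S) g &
        forall x, S x -> g (f x) = x].

Definition homoclinic_channel (R : realType) (n d : nat) (ell : nat)
    (Phi : R -> ext_phase R n d -> ext_phase R n d) (lam_p mu_m : R)
    (L : set (ext_phase R n d)) (Omp Omm : ext_phase R n d -> ext_phase R n d)
    (G : set (ext_phase R n d)) : Prop :=
  [/\ G `<=` WsL Phi lam_p L `&` WuL Phi mu_m L,
      forall x l, G x -> ext_lattice l -> G (x + l),
      forall x, G x -> exists Ts Tu,
        [/\ tangent_space (n + (d + d).+1) (WsL Phi lam_p L) x Ts,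
            tangent_space (n + (d + d).+1) (WuL Phi mu_m L) x Tu &
            (Ts + Tu = fullv)%VS],
      forall x, G x -> exists TG Fu Fs,
        [/\ tangent_space (d + d).+1 G x TG,
            tangent_space n (Wu Phi mu_m (Omm x)) x Fu,
            tangent_space n (Ws Phi lam_p (Omp x)) x Fs,
            (TG + Fu + Fs = fullv)%VS & directv (TG + Fu + Fs)%VS] &
      diffeo_onto_open ell G L Omp /\ diffeo_onto_open ell G L Omm].

(* Omp o (Omm restricted to G)^-1 *)
Definition scattering_map (R : realType) (n d : nat)
    (G : set (ext_phase R n d)) (Omp Omm : ext_phase R n d -> ext_phase R n d)
    (y : ext_phase R n d) : ext_phase R n d :=
  Omp (xget 0 [set x | G x /\ Omm x = y]).

Definition vintegrable (R : realType) (m : nat) (G : R -> 'rV[R]_m) : Prop :=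
  forall j, (@lebesgue_measure R).-integrable setT (fun s => (G s 0 j)%:E).

Definition vintegral (R : realType) (m : nat) (G : R -> 'rV[R]_m) : 'rV[R]_m :=
  \row_j \int[@lebesgue_measure R]_s G s 0 j.

(* Main.v *)
(* Along an orbit the action only moves under the perturbation. Let x be the
   perturbed orbit of the homoclinic point and y that of its foot point. The
   derivative of E = I(y) - I(x) is eps (X^1 I(y) - X^1 I(x)), which decays like
   eps exp(-D s) because x and y are asymptotic and X^1 is Lipschitz; since E
   tends to 0, E(0) is minus the integral of that derivative. Up to a time T of
   order ln (1/eps), Gronwall's inequality replaces the perturbed orbits by the
   unperturbed ones at the price of O(eps exp(L T)), while beyond T everything
   is O(exp(-D T)); balancing the two terms gives eps^rho. Applying this forward
   in time to the stable foot point and backward to the unstable one and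
   subtracting yields the formula.

   The foot points are O(eps)-close to the unperturbed one for a dynamical
   reason: p and q vanish up to O(eps) on the perturbed cylinder, E(0) = O(eps),
   and the angle difference of x and y varies only by O(eps) up to the time at
   which it is O(eps) modulo the lattice. *)
Require Import Defs.
From mathcomp Require Import measurable_realfun zify ring lra.
Set Implicit Arguments.
Unset Strict Implicit.
Unset Printing Implicit Defensive.
Local Open Scope classical_set_scope.
Local Open Scope ring_scope.

(** * Differential inequalities *)

(** The unperturbed field is only locally Lipschitz, so every comparison is confined to a ball of
    actions around [I0 = act z0.1]. The action drifts at speed O(eps) and stays in that ball for
    times of order ln (1/eps), because eps ln (1/eps) tends to 0. Two such times occur. At [T1] the
    exponential tail is at most |eps|, as the O(eps) bound on the foot points requires; Gronwall's
    factor would be a negative power of |eps| there, so that bound integrates decaying derivatives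
    instead. The time [T] is tuned to Gronwall's factor and serves the Melnikov comparison. The same
    foot point estimate at eps = 0 identifies both unperturbed foot points with the projection of
    [z0] to the cylinder. Integrals enter only through a primitive [A] of the integrand, so that all
    estimates are mean value inequalities for norms. Points live on the cover, hence each comparison
    carries a lattice vector depending on eps; it is harmless because the fields are periodic and
    the action does not see the lattice. *)

(** At the first time [s0] where [|u|] reaches [g] the slope condition forces [g - |u|] to be
    negative just before [s0]. The norm need not be differentiable, so the slopes are compared
    through backward difference quotients of [u] and [g]. *)
Lemma barrier (R : realType) (V : normedModType R) (u u' : R -> V)
    (g g' : R -> R) (a b : R) :
  (forall s : R, a <= s <= b -> is_derive s (1 : R) u (u' s)) ->
  (forall s : R, a <= s <= b -> is_derive s (1 : R) g (g' s)) ->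
  `|u a| < g a ->
  (forall s : R, a <= s <= b -> `|u s| <= g s -> `|u' s| < g' s) ->
  forall s : R, a <= s <= b -> `|u s| < g s.
Proof.
move=> du dg ug0 ug' s1 /andP[s1_ge0 s1S].
rewrite ltNge; apply/negP => gu1.
pose phi s := g s - `|u s|.
have cphi (s : R) : a <= s <= b -> {for s, continuous phi}.
  move=> sab; apply: cvgB; [|apply: cvg_norm];
    apply/differentiable_continuous/derivable1_diffP.
    by case: (dg s sab).
  by case: (du s sab).
pose A := [set s : R | a <= s /\ phi s <= 0].
have A1 : A s1 by split => //; rewrite /phi subr_le0.
have hA : has_inf A by split; [exists s1 | exists a => s []].
pose s0 := inf A.
have s0s1 : s0 <= s1 by apply: ge_inf => //; exact: hA.2.
have s0_ge0 : a <= s0 by apply: lb_le_inf; [exists s1|move=> s []].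
have s0ab : a <= s0 <= b by rewrite s0_ge0 (le_trans s0s1).
have before (s : R) : a <= s -> s < s0 -> 0 < phi s.
  move=> s_ge0 ss0; rewrite ltNge; apply/negP => ph.
  by move: ss0; rewrite ltNge ge_inf //; exact: hA.2.
have phi0_le : phi s0 <= 0.
  rewrite leNgt; apply/negP => ph.
  have : \forall s \near s0, 0 < phi s.
    by move: (cphi s0 s0ab) => /cvgr_gt; apply.
  move=> /nbhs_ballP[e /= e0 He].
  have [s As] := inf_adherent e0 hA.
  rewrite -/s0 => se.
  have s0s : s0 <= s by apply: ge_inf => //; exact: hA.2.
  have : ball s0 e s by rewrite /ball /= ler0_norm ?subr_le0// opprB ltrBlDl.
  by move/He; rewrite ltNge As.2.
have s0_gt0 : a < s0.
  rewrite lt_neqAle s0_ge0 andbT; apply/eqP => s00.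
  by move: phi0_le; rewrite -s00 /phi subr_le0 leNgt ug0.
(* By continuity from the left; this is what makes the slope hypothesis applicable at [s0]. *)
have phi0_ge : 0 <= phi s0.
  rewrite leNgt; apply/negP => ph.
  have : \forall s \near s0, phi s < 0.
    by move: (cphi s0 s0ab) => /cvgr_lt; apply.
  move=> /nbhs_ballP[e /= e0 He].
  pose h := Num.min (e / 2) ((s0 - a) / 2).
  have h0 : 0 < h by rewrite lt_min !divr_gt0// subr_gt0.
  have hs0 : h < s0 - a by rewrite gt_min; apply/orP; right; lra.
  have he : h < e by rewrite gt_min; apply/orP; left; lra.
  have /He : ball s0 e (s0 - h) by rewrite /ball /= opprB addrC subrK gtr0_norm.
  by rewrite ltNge ltW// before//; lra.
have : `|u' s0| < g' s0.
  apply: ug'; first by rewrite s0_ge0 (le_trans s0s1).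
  by rewrite -subr_ge0.
(* A third of the slope gap: the two difference quotients cost [e] each, and a strict gap [e]
   remains. *)
rewrite -subr_gt0 => slope_gt0; set e := (g' s0 - `|u' s0|) / 3.
have e_gt0 : 0 < e by rewrite divr_gt0.
have qu : \forall h \near 0^', `|h^-1 *: (u (h *: 1 + s0) - u s0) - u' s0| < e.
  have [d1 <-] := du s0 s0ab.
  move: d1 => /cvgr_dist_lt/(_ e e_gt0).
  by apply: filterS => h /=; rewrite distrC.
have qg : \forall h \near 0^', `|h^-1 *: (g (h *: 1 + s0) - g s0) - g' s0| < e.
  have [d1 <-] := dg s0 s0ab.
  move: d1 => /cvgr_dist_lt/(_ e e_gt0).
  by apply: filterS => h /=; rewrite distrC.
have [d /= d_gt0 Hd] := filterI qu qg.
pose h := Num.min (d / 2) ((s0 - a) / 2).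
have h0 : 0 < h by rewrite lt_min !divr_gt0// subr_gt0.
have hs0 : h < s0 - a by rewrite gt_min; apply/orP; right; lra.
have hd : h < d by rewrite gt_min; apply/orP; left; lra.
have [||] := Hd (- h); first by rewrite /= sub0r opprK gtr0_norm.
  by rewrite oppr_eq0 gt_eqF.
rewrite [- h *: 1]mulr1 [- h + s0]addrC => Hu Hg.
have sh : 0 < phi (s0 - h) by apply: before; lra.
have {Hg} : g (s0 - h) < g s0 - h * (g' s0 - e).
  move: Hg; rewrite invrN scaleNr -scalerN opprB ltr_norml => /andP[Hg _].
  have : h * (g' s0 - e) < h * (h^-1 * (g s0 - g (s0 - h))).
    rewrite ltr_pM2l//. move: Hg; rewrite /GRing.scale/=; lra.
  rewrite mulrA mulfV ?gt_eqF// mul1r; lra.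
have {Hu} : `|u s0| < `|u (s0 - h)| + h * (`|u' s0| + e).
  have : `|u s0 - u (s0 - h)| < h * (`|u' s0| + e).
    rewrite -ltr_pdivrMl// -[h^-1]gtr0_norm ?invr_gt0// -normrZ.
    move: Hu; rewrite invrN scaleNr -scalerN opprB => Hu.
    rewrite -[X in `|X|](subrK (u' s0)) (le_lt_trans (ler_normD _ _))//.
    by rewrite addrC ltrD2l.
  have := ler_normD (u s0 - u (s0 - h)) (u (s0 - h)); rewrite subrK; lra.
have : phi s0 <= 0 := phi0_le.
rewrite /phi in sh *.
have : h * (g' s0 - e) > h * (`|u' s0| + e).
  by rewrite ltr_pM2l// /e; move: slope_gt0; lra.
lra.
Qed.

(** The barrier [g - g a + k * (t - a + 1)] is strictly above [u - u a] at time [a] and strictly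
    steeper afterwards; the slack [k] is then sent to 0. *)
Lemma mvt_le_itv (R : realType) (V : normedModType R) (u u' : R -> V)
    (g g' : R -> R) (a b : R) : a <= b ->
  (forall s : R, a <= s <= b -> is_derive s (1 : R) u (u' s)) ->
  (forall s : R, a <= s <= b -> is_derive s (1 : R) g (g' s)) ->
  (forall s : R, a <= s <= b -> `|u' s| <= g' s) ->
  `|u b - u a| <= g b - g a.
Proof.
move=> ab du dg ug'.
apply/ler_addgt0Pr => e e_gt0.
(* Chosen so that the total slack at time [b] is exactly [e]. *)
pose k := e / (b - a + 1).
have k_gt0 : 0 < k by rewrite divr_gt0//; lra.
have dv s : a <= s <= b -> is_derive s (1 : R) (fun t => u t - u a) (u' s).
  move=> sab; have h1 := du s sab; have h2 := dg s sab; by apply: is_derive_eq; rewrite subr0.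
have dh s : a <= s <= b -> is_derive s (1 : R) (fun t => g t - g a + k * (t - a + 1)) (g' s + k).
  move=> sab; have h1 := du s sab; have h2 := dg s sab; by apply: is_derive_eq; rewrite /GRing.scale /= ; lra.
have := @barrier _ _ _ _ _ _ a b dv dh.
rewrite !subrr add0r normr0 add0r mulr1 => /(_ k_gt0).
move=> H; apply: ltW; have -> : e = k * (b - a + 1) by rewrite /k divfK//; apply: lt0r_neq0; lra.
apply: H; last by rewrite ab lexx.
by move=> s sab _; have := ug' s sab; lra.
Qed.

Lemma mvt_le (R : realType) (V : normedModType R) (u u' : R -> V)
    (g g' : R -> R) (a b : R) : a <= b ->
  (forall s : R, is_derive s (1 : R) u (u' s)) ->
  (forall s : R, is_derive s (1 : R) g (g' s)) ->
  (forall s : R, a <= s <= b -> `|u' s| <= g' s) ->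
  `|u b - u a| <= g b - g a.
Proof. by move=> ab du dg; exact: (mvt_le_itv ab (fun s _ => du s) (fun s _ => dg s)). Qed.

(** The barrier is a multiple of exp ((L + 1) (s - a)). The rate [L + 1] in place of [L] leaves a
    surplus, at least the initial value [d + k + m], that absorbs the forcing [k]; the bound thus
    has no division by [L] and covers [L = 0]. The extra [m] only provides strictness. *)
Lemma gronwall (R : realType) (V : normedModType R) (u u' : R -> V)
    (a b L k d : R) : a <= b -> 0 <= k -> 0 <= d -> 0 <= L ->
  (forall s : R, is_derive s (1 : R) u (u' s)) ->
  `|u a| <= d ->
  (forall s : R, a <= s <= b -> `|u' s| <= L * `|u s| + k) ->
  `|u b| <= (d + k) * expR ((L + 1) * (b - a)).
Proof.
move=> ab k_ge0 d_ge0 L_ge0 du ua u'le.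
set E := expR _; have E_gt0 : 0 < E := expR_gt0 _.
apply/ler_addgt0Pr => e e_gt0; pose m := e / E.
have m_gt0 : 0 < m by rewrite divr_gt0.
have -> : (d + k) * E + e = (d + k + m) * E by rewrite [in RHS]mulrDl [m * E]divfK// gt_eqF.
apply: ltW.
have dg (s : R) : is_derive s (1 : R) (fun t => (d + k + m) * expR ((L + 1) * (t - a)))
    ((L + 1) * ((d + k + m) * expR ((L + 1) * (s - a)))).
  have d1 : is_derive s (1 : R) (fun t => (L + 1) * (t - a)) (L + 1).
    by apply: is_derive_eq; rewrite /GRing.scale /=; lra.
  have d2 := is_derive1_comp (is_derive_expR _) d1.
  by apply: is_derive_eq; rewrite /GRing.scale /=; lra.
have B := @barrier _ _ _ _ _ _ a b (fun s _ => du s) (fun s _ => dg s); apply: B => [|s /andP[sa sb] us|]; last by rewrite ab lexx.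
  by rewrite subrr mulr0 expR0 mulr1; lra.
apply: (le_lt_trans (u'le s _)); first by rewrite sa.
set X := (d + k + m) * _ in us *.
have : L * `|u s| <= L * X by rewrite ler_wpM2l.
have : d + k + m <= X.
  rewrite ler_peMr//; first lra.
  by rewrite -[leLHS]expR0 ler_expR mulr_ge0//; lra.
lra.
Qed.

(** Meant for the coordinate projections of phase space: a linear contraction commutes with
    difference quotients and with their limit. *)
Lemma is_derive_linear (R : realType) (V W : normedModType R) (f : V -> W)
    (u : R -> V) (s : R) (du : V) :
  linear f -> (forall v, `|f v| <= `|v|) -> is_derive s (1 : R) u du ->
  is_derive s (1 : R) (f \o u) (f du).
Proof.
move=> linf fle [u1 udu].
have fZ c v : f (c *: v) = c *: f v.
  have f0 : f 0 = 0 by have := linf (-1) 0 0; rewrite scaler0 addr0 scaleN1r addNr.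
  by rewrite -[c *: v]addr0 linf f0 addr0.
have fB v w : f (v - w) = f v - f w.
  by rewrite addrC -scaleN1r linf scaleN1r addrC.
have fq : h^-1 *: ((f \o u) (h *: 1 + s) - (f \o u) s) @[h --> 0^'] --> f du.
  rewrite (_ : (fun h : R => _) =
      f \o (fun h : R => h^-1 *: (u (h *: 1 + s) - u s))); last first.
    by apply/funext => h /=; rewrite fZ fB.
  apply/cvgrPdist_lt => e e_gt0; move: u1 => /cvgrPdist_lt/(_ e e_gt0).
  apply: filterS => h /=; rewrite -/('D_1 u s) udu -fB.
  exact: le_lt_trans.
by split; [apply/cvg_ex; exists (f du) | exact: cvg_lim fq].
Qed.

(** Used with [c] equal to 1 or -1, to treat both directions of time alike. *)
Lemma is_derive_scale_time (R : realType) (V : normedModType R) (u : R -> V)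
    (c s : R) (du : V) : is_derive (c * s) (1 : R) u du ->
  is_derive s (1 : R) (fun t => u (c * t)) (c *: du).
Proof.
move=> [u1 udu].
have d1 : differentiable u (c * s) by apply/derivable1_diffP.
have d2 : is_derive s (1 : R) (fun t : R => c * t) c.
  by apply: is_derive_eq; rewrite /GRing.scale /= mulr1.
have [d3 e3] := d2; move: (d3) => /derivable1_diffP d4.
have d5 : differentiable (u \o (fun t : R => c * t)) s by exact: differentiable_comp.
split; first exact/derivable1_diffP.
have e4 : 'd (fun t : R => c * t) s 1 = c by rewrite -deriveE.
rewrite deriveE// (@diff_comp _ _ _ _ (fun t : R => c * t) u)//= e4.
by rewrite -[c in 'd _ _ c]mulr1 -[c * 1]/(c *: 1) linearZ /= -deriveE// udu.
Qed.

(** * The distance on the extended phase space *)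

Lemma pair_norm_le (R : realType) (V W : normedModType R) (x : V * W) (e : R) :
  (`|x| <= e) = (`|x.1| <= e) && (`|x.2| <= e).
Proof. by rewrite prod_normE ge_max. Qed.

Section coordinates.
Context (R : realType) (n d : nat).
Implicit Types (z : phase R n d) (w : ext_phase R n d).

Lemma norm_fst (V W : normedModType R) (x : V * W) : `|x.1| <= `|x|.
Proof. by rewrite prod_normE le_max lexx. Qed.

Lemma norm_snd (V W : normedModType R) (x : V * W) : `|x.2| <= `|x|.
Proof. by rewrite prod_normE le_max lexx orbT. Qed.

Lemma norm_act z : `|act z| <= `|z|.
Proof. exact: (le_trans (norm_fst z.2) (norm_snd z)). Qed.

Lemma norm_ang z : `|ang z| <= `|z|.
Proof. exact: (le_trans (norm_snd z.2) (norm_snd z)). Qed.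

Lemma ext_lattice0 : @ext_lattice R n d 0.
Proof. by split => //; split => // i; rewrite mxE. Qed.

Lemma ext_latticeB w1 w2 : ext_lattice w1 -> ext_lattice w2 ->
  ext_lattice (w1 - w2).
Proof.
move=> [[m1 a1 p1 t1] e1] [[m2 a2 p2 t2] e2]; split; last first.
  by rewrite /= e1 e2 subr0.
split; rewrite ?/mom ?/act /=.
- by move: m1 m2; rewrite /mom => -> ->; rewrite subr0.
- by move: a1 a2; rewrite /act => -> ->; rewrite subr0.
- by move=> i; rewrite !mxE rpredB; [|exact: p1|exact: p2].
- by move=> i; rewrite !mxE rpredB; [|exact: t1|exact: t2].
Qed.

Lemma ext_latticeN w : ext_lattice w -> ext_lattice (- w).
Proof. by move=> ?; rewrite -sub0r; apply: ext_latticeB => //; exact: ext_lattice0. Qed.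

Lemma ext_latticeD w1 w2 : ext_lattice w1 -> ext_lattice w2 ->
  ext_lattice (w1 + w2).
Proof. by move=> ? ?; rewrite -[w2]opprK; apply/ext_latticeB/ext_latticeN. Qed.

Lemma distM_le w1 w2 l : ext_lattice l -> distM w1 w2 <= `|w1 - w2 - l|.
Proof.
move=> hl; apply: ge_inf; last by exists l.
by exists 0 => _ [? _ <-].
Qed.

Lemma le_distM w1 w2 c : (forall l, ext_lattice l -> c <= `|w1 - w2 - l|) ->
  c <= distM w1 w2.
Proof.
move=> h; apply: lb_le_inf; last by move=> _ [l hl <-]; exact: h.
by exists `|w1 - w2 - 0|, 0 => //; exact: ext_lattice0.
Qed.

Lemma distM_ge0 w1 w2 : 0 <= distM w1 w2.
Proof. exact: le_distM. Qed.

Lemma distM_adherent w1 w2 e : distM w1 w2 < e ->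
  exists2 l, ext_lattice l & `|w1 - w2 - l| < e.
Proof.
move=> h; apply: contrapT => H; move: h; apply/negP; rewrite -leNgt.
apply: le_distM => l hl; rewrite leNgt; apply/negP => h.
by apply: H; exists l.
Qed.

Lemma distM_shift w1 w2 l : ext_lattice l -> distM w1 (w2 + l) = distM w1 w2.
Proof.
move=> hl; apply/eqP; rewrite eq_le; apply/andP; split; apply: le_distM => k hk.
  have -> : w1 - w2 - k = w1 - (w2 + l) - (k - l).
    by rewrite !opprD opprK !addrA [in RHS]addrAC addrNK.
  by apply: distM_le; exact: ext_latticeB.
have -> : w1 - (w2 + l) - k = w1 - w2 - (l + k) by rewrite !opprD !addrA.
by apply: distM_le; exact: ext_latticeD.
Qed.

(** Lattice vectors have zero action, so the distance in M controls actions without any choice of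
    lift. *)
Lemma norm_actB_distM w1 w2 : `|act w1.1 - act w2.1| <= distM w1 w2.
Proof.
apply: le_distM => l [[_ al _ _] _].
rewrite (_ : act w1.1 - act w2.1 = act (w1 - w2 - l).1).
  exact: le_trans (norm_act _) (norm_fst _).
by move: al; rewrite /act /= => ->; rewrite subr0.
Qed.

Lemma norm_timeB_distM w1 w2 : `|w1.2 - w2.2| <= distM w1 w2.
Proof.
apply: le_distM => l [_ l2].
by rewrite (_ : w1.2 - w2.2 = (w1 - w2 - l).2) ?norm_snd//= l2 subr0.
Qed.

End coordinates.

(** * Estimates along orbits *)

(* [X0] is only Lipschitz near the action [I0]: nothing bounds the frequency map
   at infinity. *)
Record tame_system (R : realType) (n d : nat) (X0 : phase R n d -> phase R n d)
    (X1 : phase R n d -> R -> R -> phase R n d) (eps0 : R) (I0 : 'rV[R]_d)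
    (r1 L B : R) : Prop := TameSystem {
  tame_L : 0 <= L;
  tame_B : 0 <= B;
  tame_act : forall z, act (X0 z) = 0;
  tame_per0 : periodic_on_M X0;
  tame_lip0 : forall z z', `|act z - I0| < r1 -> `|act z' - I0| < r1 ->
    `|X0 z - X0 z'| <= L * `|z - z'|;
  tame_ang : forall z z', `|act z - I0| < r1 -> `|act z' - I0| < r1 ->
    `|ang (X0 z) - ang (X0 z')| <= L * `|act z - act z'|;
  tame_per1 : forall t eps, periodic_on_M (fun z => X1 z t eps);
  tame_bound : forall z t eps, `|eps| < eps0 -> `|X1 z t eps| <= B;
  tame_lip1 : forall z z' t t' eps eps', `|eps| < eps0 -> `|eps'| < eps0 ->
    `|X1 z t eps - X1 z' t' eps'| <= L * `|(z, t, eps) - (z', t', eps')| }.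

(* [s] is 1 or -1, the direction of time. *)
Definition orbit_of (R : realType) (V : normedModType R) (X : V -> V) (s : R)
    (x : R -> V) : Prop :=
  forall t : R, is_derive t (1 : R) x (s *: X (x t)).

Lemma exp_small (R : realType) (lam C e s : R) : lam < 0 -> 0 < e ->
  exists2 S, s <= S & C * expR (S * lam) <= e.
Proof.
move=> lam0 e0; case: (leP C 0) => [C0|C0].
  by exists s => //; apply: (le_trans _ (ltW e0)); rewrite pmulr_lle0// expR_gt0.
exists (Num.max s (ln (e / C) / lam)); first by rewrite le_max lexx.
rewrite mulrC -ler_pdivlMr// -[leRHS]lnK ?posrE ?divr_gt0// ler_expR.
by rewrite -ler_ndivrMr// le_max lexx orbT.
Qed.

Section tame.
Context (R : realType) (n d : nat) (X0 : phase R n d -> phase R n d)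
  (X1 : phase R n d -> R -> R -> phase R n d) (eps0 : R) (I0 : 'rV[R]_d)
  (r1 L B : R).
Hypothesis tame : tame_system X0 X1 eps0 I0 r1 L B.
Variables (sg : R) (sg1 : `|sg| = 1).

Let field := ext_field X0 X1.
Let L_ge0 : 0 <= L. Proof. exact: tame_L tame. Qed.
Let B_ge0 : 0 <= B. Proof. exact: tame_B tame. Qed.

Lemma is_derive_act (x : R -> ext_phase R n d) (dx : ext_phase R n d) (s : R) :
  is_derive s (1 : R) x dx ->
  is_derive s (1 : R) (fun t => act (x t).1) (act dx.1).
Proof.
apply: (@is_derive_linear _ _ _ (fun w : ext_phase R n d => act w.1)) => // w.
exact: (le_trans (norm_act _) (norm_fst w)).
Qed.

Lemma is_derive_ang (x : R -> ext_phase R n d) (dx : ext_phase R n d) (s : R) :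
  is_derive s (1 : R) x dx ->
  is_derive s (1 : R) (fun t => ang (x t).1) (ang dx.1).
Proof.
apply: (@is_derive_linear _ _ _ (fun w : ext_phase R n d => ang w.1)) => // w.
exact: (le_trans (norm_ang _) (norm_fst w)).
Qed.

Lemma is_derive_time (x : R -> ext_phase R n d) (dx : ext_phase R n d) (s : R) :
  is_derive s (1 : R) x dx -> is_derive s (1 : R) (fun t => (x t).2) dx.2.
Proof.
apply: (@is_derive_linear _ _ _ (fun w : ext_phase R n d => w.2)) => // w.
exact: norm_snd.
Qed.

Lemma is_derive_exp (k c s : R) :
  is_derive s (1 : R) (fun t => k * expR (t * c)) (k * c * expR (s * c)).
Proof.
have d1 : is_derive s (1 : R) (fun t : R => t * c) c.
  by apply: is_derive_eq; rewrite /GRing.scale /=; lra.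
have d2 := is_derive1_comp (is_derive_expR _) d1.
by apply: is_derive_eq; rewrite /GRing.scale /=; lra.
Qed.

Lemma act_ext_field eps w : act (field eps w).1 = eps *: act (X1 w.1 w.2 eps).
Proof.
rewrite /field /ext_field /=; have := tame_act tame w.1.
by rewrite /act /= => ->; rewrite add0r.
Qed.

Lemma norm_ext_paramB (w w' l : ext_phase R n d) (eps eps' : R) : l.2 = 0 ->
  `|(w.1, w.2, eps) - (w'.1 + l.1, w'.2, eps')| =
  Num.max `|w - w' - l| `|eps - eps'|.
Proof.
move=> l2; rewrite [LHS]prod_normE; congr (Num.max _ _); congr `|_|.
rewrite [RHS]surjective_pairing; congr pair; first by rewrite /= opprD addrA.
by rewrite /= l2 subr0.
Qed.

(** Periodicity allows [w'] to be moved by a nearly optimal lattice vector before the Lipschitz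
    bound on the cover is applied. *)
Lemma X1_lip_distM eps w w' : `|eps| < eps0 ->
  `|X1 w.1 w.2 eps - X1 w'.1 w'.2 eps| <= L * distM w w'.
Proof.
move=> he; apply/ler_addgt0Pr => e e0.
have L0 := L_ge0; have L1 : 0 < L + 1 by lra.
(* The denominator [L + 1] keeps the tolerance meaningful when [L = 0]. *)
have k0 : 0 < e / (L + 1) by rewrite divr_gt0.
have [] := @distM_adherent R n d w w' (distM w w' + e / (L + 1)); first lra.
move=> l [hl l2] hd.
rewrite -(tame_per1 tame w'.2 eps w'.1 hl).
apply: (le_trans (tame_lip1 tame _ _ _ _ he he)).
rewrite norm_ext_paramB// subrr normr0 max_l//.
have H : L * `|w - w' - l| <= L * (distM w w' + e / (L + 1)).
  by rewrite ler_wpM2l// ltW.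
apply: (le_trans H); rewrite mulrDr lerD2l mulrA ler_pdivrMr//.
by rewrite mulrDr mulr1 mulrC lerDl ltW.
Qed.

(** The field has action component eps times that of [X1], of norm at most [|eps| * B]. At eps = 0
    the bound says that the action is constant. *)
Lemma act_drift eps x s : `|eps| < eps0 -> orbit_of (field eps) sg x -> 0 <= s ->
  `|act (x s).1 - act (x 0).1| <= `|eps| * B * s.
Proof.
move=> he dx s0.
have dg (t : R) : is_derive t (1 : R) (fun t => `|eps| * B * t) (`|eps| * B).
  by apply: is_derive_eq; rewrite /GRing.scale /= mulr1.
have := mvt_le s0 (fun t => is_derive_act (dx t)) dg.
rewrite mulr0 subr0; apply => t _.
rewrite -[act _]/(sg *: act (field eps (x t)).1) act_ext_field !normrZ sg1 mul1r.
by rewrite ler_wpM2l// (le_trans (norm_act _))// (tame_bound tame).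
Qed.

Section asymptotic_orbits.
Variables (eps : R) (eps_lt : `|eps| < eps0) (lam C : R) (lam_lt0 : lam < 0).
Variables (x y : R -> ext_phase R n d).
Hypotheses (orb_x : orbit_of (field eps) sg x) (orb_y : orbit_of (field eps) sg y).
Hypothesis dist_xy : forall s, 0 <= s -> distM (x s) (y s) <= C * expR (s * lam).

Let C_ge0 : 0 <= C.
Proof.
have := dist_xy (lexx 0); rewrite mul0r expR0 mulr1.
exact/le_trans/distM_ge0.
Qed.

Lemma X1_diff_le s : 0 <= s ->
  `|X1 (y s).1 (y s).2 eps - X1 (x s).1 (x s).2 eps| <= L * C * expR (s * lam).
Proof.
move=> s0; rewrite distrC (le_trans (X1_lip_distM _ _ eps_lt))//.
by rewrite -mulrA ler_wpM2l// dist_xy.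
Qed.

(* The action difference tends to 0 and its derivative carries a factor [eps]. *)
Lemma act_diff_le s : 0 <= s ->
  `|act (y s).1 - act (x s).1| <= `|eps| * (L * C / - lam) * expR (s * lam).
Proof.
move=> s0; apply/ler_addgt0Pr => e e0.
have [S sS Se] := exp_small C s lam_lt0 e0.
(* With this [k], [k * expR (s * lam)] is the negative primitive of the bound on the derivative, and
   it increases to 0. *)
pose k := - (`|eps| * (L * C / - lam)).
have dE t : is_derive t (1 : R) (fun t => act (y t).1 - act (x t).1)
    (act (sg *: field eps (y t)).1 - act (sg *: field eps (x t)).1).
  by have := is_derive_act (orb_y t); have := is_derive_act (orb_x t) => h1 h2;
     apply: is_derive_eq.
have := mvt_le sS dE (is_derive_exp k lam).
have hk : k * lam = `|eps| * (L * C).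
  by rewrite /k; field; rewrite lt_eqF.
rewrite hk => /(_ _)/wrap[t /andP[st _]|].
  rewrite -[act (_ *: _).1]/(sg *: act (field eps (y t)).1).
  rewrite -[act (_ *: field eps (x t)).1]/(sg *: act (field eps (x t)).1).
  rewrite -scalerBr normrZ sg1 mul1r !act_ext_field -scalerBr normrZ -mulrA.
  rewrite ler_wpM2l//; apply: le_trans (X1_diff_le (le_trans s0 st)).
  exact: norm_act (X1 (y t).1 (y t).2 eps - X1 (x t).1 (x t).2 eps).
have ES : `|act (y S).1 - act (x S).1| <= e.
  rewrite distrC (le_trans (norm_actB_distM _ _))// (le_trans _ Se)//.
  exact/dist_xy/(le_trans s0).
set E1 := act _ - _ in ES *; set E0 := act _ - _ => H.
have : `|E0| <= `|E1| + `|E1 - E0|.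
  by have := ler_normB E1 (E1 - E0); rewrite subKr.
have k_le0 : k * expR (S * lam) <= 0.
  rewrite /k mulNr oppr_le0 mulr_ge0// ?expR_ge0// mulr_ge0//.
  by rewrite divr_ge0// ?oppr_ge0 ?(ltW lam_lt0)// mulr_ge0.
rewrite /k in k_le0 H; rewrite mulNr in k_le0; move: H; rewrite !mulNr.
lra.
Qed.

Section near_I0.
Variables (T : R) (T_ge0 : 0 <= T).
Hypothesis near_I0 :
  `|act (x 0).1 - I0| + `|eps| * (B * T + L * C / - lam) < r1.

Let K1 := L * C / - lam.
Let K1_ge0 : 0 <= K1.
Proof.
rewrite /K1 divr_ge0 ?oppr_ge0 ?(ltW lam_lt0)//.
by rewrite mulr_ge0.
Qed.

(** The drift keeps [x] in the ball up to time [T], and [act_diff_le] keeps [y] within [|eps| * K1]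
    of it; from here on the local Lipschitz bounds on [X0] are available. *)
Lemma act_near_I0 s : 0 <= s <= T ->
  `|act (x s).1 - I0| < r1 /\ `|act (y s).1 - I0| < r1.
Proof.
move=> /andP[s0 sT].
have hx : `|act (x s).1 - I0| <= `|act (x 0).1 - I0| + `|eps| * (B * T).
  rewrite -(subrK (act (x 0).1) (act (x s).1)) -addrA addrC.
  apply: (le_trans (ler_normD _ _)); rewrite lerD2l.
  apply: (le_trans (act_drift eps_lt orb_x s0)).
  by rewrite -mulrA ler_wpM2l// ler_wpM2l.
have h : `|eps| * (B * T) <= `|eps| * (B * T + K1) by rewrite ler_wpM2l// lerDl.
have hn : `|act (x 0).1 - I0| + `|eps| * (B * T + K1) < r1 := near_I0.
split; first lra.
rewrite -(subrK (act (x s).1) (act (y s).1)) -addrA.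
apply: (le_lt_trans (ler_normD _ _)).
have := act_diff_le s0; rewrite -/K1.
have : `|eps| * K1 * expR (s * lam) <= `|eps| * K1.
  rewrite ler_piMr//; first by rewrite mulr_ge0// K1_ge0.
  by rewrite -[leRHS]expR0 ler_expR mulr_ge0_le0// ltW.
by rewrite mulrDr in hn; lra.
Qed.

(** The unperturbed angular velocity depends on the action alone, so the angle gap has a derivative
    bounded by [L] times the action gap plus the gap in [X1]. Both carry a factor eps and decay
    exponentially, whence a bound uniform in [T]. *)
Lemma ang_diff_le :
  `|(ang (y T).1 - ang (x T).1) - (ang (y 0).1 - ang (x 0).1)| <=
  `|eps| * (L * (K1 + C) / - lam).
Proof.
pose k := - (`|eps| * (L * (K1 + C) / - lam)).
have dE t : is_derive t (1 : R) (fun t => ang (y t).1 - ang (x t).1)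
    (ang (sg *: field eps (y t)).1 - ang (sg *: field eps (x t)).1).
  have h1 := is_derive_ang (orb_y t); have h2 := is_derive_ang (orb_x t).
  exact: is_derive_eq.
have hk : k * lam = `|eps| * (L * (K1 + C)).
  by rewrite /k; field; rewrite lt_eqF.
have := mvt_le T_ge0 dE (is_derive_exp k lam).
rewrite hk => H; apply: le_trans (H _) _ => [t /[dup] tT /andP[t0 _]|].
  rewrite -[ang (_ *: _).1]/(sg *: ang (field eps (y t)).1).
  rewrite -[ang (_ *: field eps (x t)).1]/(sg *: ang (field eps (x t)).1).
  rewrite -scalerBr normrZ sg1 mul1r.
  have [hx hy] := act_near_I0 tT.
  rewrite (_ : _ - _ = (ang (X0 (y t).1) - ang (X0 (x t).1)) + eps *:
    ang (X1 (y t).1 (y t).2 eps - X1 (x t).1 (x t).2 eps)); last first.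
    by rewrite scalerBr addrACA -opprD.
  apply: (le_trans (ler_normD _ _)).
  have h1 := tame_ang tame hy hx.
  have h2 : L * `|act (y t).1 - act (x t).1| <= L * (`|eps| * K1 * expR (t * lam)).
    by rewrite ler_wpM2l// act_diff_le.
  have h3 : `|eps *: ang (X1 (y t).1 (y t).2 eps - X1 (x t).1 (x t).2 eps)| <=
      `|eps| * (L * C * expR (t * lam)).
    rewrite normrZ ler_wpM2l// (le_trans (norm_ang _))//.
    exact: X1_diff_le.
  move: h1 h2 h3; lra.
rewrite mul0r expR0 mulr1 /k.
rewrite mulNr opprK gerDr oppr_le0 mulr_ge0// ?expR_ge0// mulr_ge0//.
rewrite divr_ge0// ?oppr_ge0 ?(ltW lam_lt0)//.
by rewrite mulr_ge0// addr_ge0.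
Qed.

(* The fibre coordinates of [y 0] come from the cylinder, the base coordinates
   from the orbits at time [T], where they are close modulo the lattice. *)
Lemma foot_close K0 b l' : ext_lattice l' ->
  `|y 0 - l' - (((0, 0), (b.1.1, b.1.2)), b.2 : R)| <= K0 * `|eps| ->
  exists2 l, ext_lattice l &
    `|y 0 - ((0, 0, (act (x 0).1, ang (x 0).1)), (x 0).2) - l| <=
    (K0 + K1 + L * (K1 + C) / - lam) * `|eps| + (C + 1) * expR (T * lam).
Proof.
move=> [[ml' al' pl' tl'] l'2] hy0.
have K0_ge0 : 0 <= K0 * `|eps| by apply: le_trans hy0.
pose E := expR (T * lam); have E_gt0 : 0 < E := expR_gt0 _.
have [] := @distM_adherent R n d (x T) (y T) ((C + 1) * E).
  by apply: le_lt_trans (dist_xy T_ge0) _; rewrite ltr_pM2r//; lra.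
move=> l [[ml al pl tl] l2] hT.
(* The position shift is read off the cylinder at time 0, the angle shift off the orbits at time
   [T]; the sign changes because [l] was found for [x - y]. *)
exists ((0, pos l'.1, (0, - ang l.1)), 0).
  by split => //; split => // i; rewrite /ang /= mxE rpredN; exact: tl.
have C0 := C_ge0; have CE : 0 <= (C + 1) * E by rewrite mulr_ge0// ?ltW//; lra.
have K2_ge0 : 0 <= L * (K1 + C) / - lam.
  rewrite divr_ge0// ?oppr_ge0 ?(ltW lam_lt0)//.
  by rewrite mulr_ge0// addr_ge0.
have e0 : 0 <= `|eps| * (L * (K1 + C) / - lam) by rewrite mulr_ge0.
have e1 : 0 <= `|eps| * K1 by rewrite mulr_ge0 ?K1_ge0.
have := ang_diff_le; have := act_diff_le (lexx 0).
rewrite mul0r expR0 mulr1 -/K1 -/E => hact hang.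
have dist_T := dist_xy T_ge0; rewrite -/E in dist_T.
move: K2_ge0 e0 e1 hang hact; set K2 := _ / - lam => K2_ge0 e0 e1 hang hact.
rewrite [_ * `|eps|]mulrC !mulrDr.
clearbody K2 E K1.
rewrite !pair_norm_le /=; apply/andP; split; [apply/andP; split; apply/andP; split|].
- rewrite !subr0.
  have : `|mom (y 0 - l' - (0, 0, (b.1.1, b.1.2), b.2)).1| <= K0 * `|eps|.
    apply: le_trans hy0; apply: le_trans (norm_fst _).
    exact: (le_trans (norm_fst _) (norm_fst _)).
  move: ml'; rewrite /mom /= => ->; rewrite !subr0; lra.
- rewrite !subr0.
  have : `|pos (y 0 - l' - (0, 0, (b.1.1, b.1.2), b.2)).1| <= K0 * `|eps|.
    apply: le_trans hy0; apply: le_trans (norm_fst _).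
    exact: (le_trans (norm_snd _) (norm_fst _)).
  rewrite /pos /= subr0; lra.
- rewrite !subr0; lra.
- have hT' : `|ang (y T).1 - ang (x T).1 + ang l.1| <= (C + 1) * E.
    apply: le_trans (ltW hT); rewrite -normrN opprD opprB.
    exact: (le_trans (norm_ang (x T - y T - l).1) (norm_fst _)).
  move: hang; rewrite /= opprK.
  rewrite -[(y 0).1.2.2]/(ang (y 0).1).
  set v1 := ang (y T).1 - _ in hT' *; set v0 := ang (y 0).1 - _ => H.
  have -> : v0 + ang l.1 = (v1 + ang l.1) - (v1 - v0).
    by rewrite opprB [in RHS]addrC addrA subrK.
  have := ler_normB (v1 + ang l.1) (v1 - v0); lra.
(* Both clocks run at the same rate, so the time gap is constant and can be bounded at [T]. *)
- have dt t : is_derive t (1 : R) (fun t => (y t).2 - (x t).2) 0.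
    have h1 := is_derive_time (orb_y t); have h2 := is_derive_time (orb_x t).
    by apply: is_derive_eq; rewrite /= subrr.
  have := mvt_le T_ge0 dt (fun t => is_derive_cst (0 : R) t 1).
  rewrite subr0 normr0 => /(_ (fun _ _ => lexx _)).
  rewrite normr_le0 => /eqP h.
  have := norm_timeB_distM (x T) (y T).
  rewrite distrC subr0; move: h; move/subr0_eq => ->; lra.
Qed.

End near_I0.
End asymptotic_orbits.

(** Gronwall applied to [u - v - l], with forcing [|eps| * B]. Periodicity of [X0] lets [v] be
    translated by [l]; the Lipschitz bound applies because [u] drifts slowly and [v] has constant
    action. *)
Lemma orbit_compare eps u v l de S : `|eps| < eps0 -> 0 <= S ->
  orbit_of (field eps) sg u -> orbit_of (field 0) sg v -> ext_lattice l ->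
  0 <= de -> `|u 0 - v 0 - l| <= de ->
  `|act (u 0).1 - I0| + `|eps| * (B * S) < r1 -> `|act (v 0).1 - I0| < r1 ->
  `|u S - v S - l| <= (de + `|eps| * B) * expR ((L + 1) * S).
Proof.
move=> he S0 ou ov [hl l2] de0 h0 hu hv.
have eps00 : `|0 : R| < eps0 by rewrite normr0 (le_lt_trans _ he).
have dw t : is_derive t (1 : R) (fun t => u t - v t - l)
    (sg *: field eps (u t) - sg *: field 0 (v t)).
  have h1 := ou t; have h2 := ov t.
  by apply: is_derive_eq; rewrite subr0.
rewrite -[X in expR (_ * X)]subr0.
apply: (gronwall S0 _ de0 L_ge0 dw h0); first by rewrite mulr_ge0.
move=> t /andP[t0 tS]; rewrite -scalerBr normrZ sg1 mul1r.
have hut : `|act (u t).1 - I0| < r1.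
  apply: le_lt_trans hu; rewrite -(subrK (act (u 0).1) (act (u t).1)) -addrA addrC.
  apply: (le_trans (ler_normD _ _)); rewrite lerD2l.
  apply: (le_trans (act_drift he ou t0)).
  by rewrite -mulrA ler_wpM2l// ler_wpM2l.
have hvt : `|act ((v t).1 + l.1) - I0| < r1.
  have [_ al _ _] := hl; rewrite /act /= -/(act _) -/(act _) al addr0.
  have := act_drift eps00 ov t0; rewrite normr0 !mul0r normr_le0 subr_eq0.
  by move=> /eqP ->.
rewrite (_ : field eps (u t) - field 0 (v t) =
    (X0 (u t).1 - X0 ((v t).1 + l.1) + eps *: X1 (u t).1 (u t).2 eps, 0)); last first.
  rewrite (tame_per0 tame)// /field /ext_field scale0r addr0.
  by congr pair; rewrite /= ?subrr// addrAC.
rewrite prod_normE /= normr0 max_l//.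
apply: (le_trans (ler_normD _ _)); apply: lerD; last first.
  by rewrite normrZ ler_wpM2l// (tame_bound tame).
apply: (le_trans (tame_lip0 tame hut hvt)); rewrite ler_wpM2l//.
by apply: le_trans (norm_fst _); rewrite /= opprD addrA.
Qed.

(* The action difference and [eps] times the unperturbed integral have close
   derivatives up to time [T], and the action difference is small at [T]. *)
Lemma half_melnikov eps lam C (x y x0 y0 : R -> ext_phase R n d) lx ly de T
    (A : R -> 'rV[R]_d) :
  `|eps| < eps0 -> lam < 0 -> 0 <= T -> 0 <= de ->
  orbit_of (field eps) sg x -> orbit_of (field eps) sg y ->
  orbit_of (field 0) sg x0 -> orbit_of (field 0) sg y0 ->
  (forall s, 0 <= s -> distM (x s) (y s) <= C * expR (s * lam)) ->
  ext_lattice lx -> ext_lattice ly ->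
  `|x 0 - x0 0 - lx| <= de -> `|y 0 - y0 0 - ly| <= de ->
  `|act (x 0).1 - I0| + `|eps| * (B * T) < r1 ->
  `|act (y 0).1 - I0| + `|eps| * (B * T) < r1 ->
  `|act (x0 0).1 - I0| < r1 -> `|act (y0 0).1 - I0| < r1 ->
  (forall s : R, is_derive s (1 : R) A
     (act (X1 (y0 s).1 (y0 s).2 0) - act (X1 (x0 s).1 (x0 s).2 0))) ->
  `|act (y 0).1 - act (x 0).1 + (sg * eps) *: (A T - A 0)| <=
  `|eps| * (L * C / - lam * expR (T * lam) +
            2 * (de + `|eps| * (B + 1)) * expR ((L + 1) * T)).
Proof.
move=> he lam0 T0 de0 ox oy ox0 oy0 dxy hlx hly hx hy nx ny nx0 ny0 dA.
have eps00 : `|0 : R| < eps0 by rewrite normr0 (le_lt_trans _ he).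
pose c := 2 * `|eps| * (de + `|eps| * (B + 1)).
have B1 : 0 <= B + 1 by have := B_ge0; lra.
have c0 : 0 <= c by rewrite !mulr_ge0// addr_ge0// mulr_ge0.
pose W t := act (y t).1 - act (x t).1 - (sg * eps) *: A t.
have dW t : is_derive t (1 : R) W
    (act (sg *: field eps (y t)).1 - act (sg *: field eps (x t)).1 -
     (sg * eps) *: (act (X1 (y0 t).1 (y0 t).2 0) - act (X1 (x0 t).1 (x0 t).2 0))).
  have h1 := is_derive_act (oy t); have h2 := is_derive_act (ox t).
  have h3 := dA t.
  exact: is_derive_eq.
(* The comparison also changes the parameter of [X1] from eps to 0; this accounts for [B + 1] where
   [orbit_compare] has [B]. *)
have X1close u v l t : orbit_of (field eps) sg u -> orbit_of (field 0) sg v ->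
    ext_lattice l -> `|u 0 - v 0 - l| <= de ->
    `|act (u 0).1 - I0| + `|eps| * (B * T) < r1 -> `|act (v 0).1 - I0| < r1 ->
    0 <= t <= T ->
    `|X1 (u t).1 (u t).2 eps - X1 (v t).1 (v t).2 0| <=
      L * ((de + `|eps| * (B + 1)) * expR ((L + 1) * t)).
  move=> ou ov hl h0 nu nv /andP[t0 tT].
  have [hl1 l2] := hl.
  rewrite -(tame_per1 tame (v t).2 0 (v t).1 hl1).
  apply: (le_trans (tame_lip1 tame _ _ _ _ he eps00)); rewrite ler_wpM2l//.
  have nu' : `|act (u 0).1 - I0| + `|eps| * (B * t) < r1.
    by apply: le_lt_trans nu; rewrite lerD2l ler_wpM2l// ler_wpM2l.
  have hc := orbit_compare he t0 ou ov hl de0 h0 nu' nv.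
  have hE : 1 <= expR ((L + 1) * t).
    by rewrite -[leLHS]expR0 ler_expR mulr_ge0// addr_ge0.
  have heps : `|eps| <= `|eps| * expR ((L + 1) * t) by rewrite ler_peMr.
  have hdB : 0 <= (de + `|eps| * B) * expR ((L + 1) * t).
    by rewrite mulr_ge0 ?expR_ge0// addr_ge0// mulr_ge0.
  have -> : (de + `|eps| * (B + 1)) * expR ((L + 1) * t) =
     (de + `|eps| * B) * expR ((L + 1) * t) + `|eps| * expR ((L + 1) * t).
    by ring.
  rewrite norm_ext_paramB// ge_max subr0; apply/andP; split.
    by apply: (le_trans hc); rewrite lerDl mulr_ge0 ?expR_ge0.
  by apply: (le_trans heps); rewrite lerDr.
(* The majorant has derivative [c * (L + 1) * expR (t * (L + 1))], slightly more than the required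
   factor [c * L]. *)
have := mvt_le T0 dW (is_derive_exp c (L + 1)).
rewrite mul0r expR0 mulr1 => /(_ _)/wrap[t tT|hW].
  rewrite -[act (_ *: _).1]/(sg *: act (field eps (y t)).1).
  rewrite -[act (_ *: field eps (x t)).1]/(sg *: act (field eps (x t)).1).
  rewrite -scalerBr !act_ext_field -scalerBr scalerA -scalerBr normrZ normrM sg1 mul1r.
  have h1 := X1close _ _ _ _ ox ox0 hlx hx nx nx0 tT.
  have h2 := X1close _ _ _ _ oy oy0 hly hy ny ny0 tT.
  apply: (@le_trans _ _ (`|eps| * (2 * (L * ((de + `|eps| * (B + 1)) * expR ((L + 1) * t)))))).
    rewrite ler_wpM2l//.
    have -> (a b c' d' : 'rV[R]_d) : a - b - (c' - d') = (a - c') - (b - d').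
      by rewrite !opprB addrACA [in RHS]addrACA; congr (_ + _); rewrite addrC.
    apply: (le_trans (ler_normB _ _)); rewrite mulr_natl mulr2n; apply: lerD.
      exact: le_trans (norm_act (X1 (y t).1 (y t).2 eps - X1 (y0 t).1 (y0 t).2 0)) h2.
    exact: le_trans (norm_act (X1 (x t).1 (x t).2 eps - X1 (x0 t).1 (x0 t).2 0)) h1.
  rewrite (_ : _ * (2 * _) = c * L * expR ((L + 1) * t)); last by rewrite /c; ring.
  rewrite [t * _]mulrC ler_wpM2r ?expR_ge0// ler_wpM2l//; lra.
have hE := act_diff_le he lam0 ox oy dxy T0.
(* The quantity to be bounded is the action gap at time [T], small by asymptoticity, minus the
   variation of [W]. *)
rewrite (_ : _ + _ = (act (y T).1 - act (x T).1) - (W T - W 0)); last first.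
  rewrite /W scalerBr; set p := _ *: A T; set q := _ *: A 0.
  set E1 := act _ - _; set E0 := act _ - _.
  by rewrite opprB [in RHS]addrCA subKr addrA addrAC.
apply: (le_trans (ler_normB _ _)).
rewrite [T * (L + 1)]mulrC in hW; rewrite mulrDr.
have := expR_ge0 ((L + 1) * T); set E := expR ((L + 1) * T) in hW *.
move: hE hW; rewrite -/c; set M := `|W T - W 0|; rewrite !mulrA -/c => hE hW E0.
have -> : `|eps| * 2 * (de + `|eps| * (B + 1)) = c by rewrite /c; ring.
lra.
Qed.

End tame.

(** * Lipschitz bounds from derivatives *)

Lemma rV_norm_le (R : realType) (m : nat) (v : 'rV[R]_m) (e : R) : 0 <= e ->
  (forall j, `|v 0 j| <= e) -> `|v| <= e.
Proof.
move=> e0 h; rewrite /Num.norm /=.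
case: (eqVneq (mx_norm v) 0) => [-> //|/mx_norm_neq0 [[i j] ->]] /=.
by rewrite (ord1 i).
Qed.

Lemma rV_norm_ge (R : realType) (m : nat) (v : 'rV[R]_m) j : `|v 0 j| <= `|v|.
Proof.
rewrite [leRHS]/Num.norm /= mx_normrE.
exact: (le_bigmax 0 (fun ij : 'I_1 * 'I_m => `|v ij.1 ij.2|) (0, j)).
Qed.

(** The uniform boundedness principle, stated as a property of the spaces so that it can be built up
    along the nested products of row vectors that form phase space. It turns separate bounds on the
    directional derivatives into one bound on the differentials. *)
Definition uniformly_bounding (R : realType) (V W : normedModType R) : Prop :=
  forall (I : Type) (T : I -> V -> W), (forall i, linear (T i)) ->
    (forall v, exists B, forall i, `|T i v| <= B) ->
    exists2 K, 0 <= K & forall i v, `|T i v| <= K * `|v|.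

Lemma linear_map0 (R : realType) (V W : normedModType R) (f : V -> W) :
  linear f -> f 0 = 0.
Proof.
by move=> linf; have := linf (-1) 0 0; rewrite scaler0 addr0 scaleN1r addNr.
Qed.

Lemma linear_sumZ (R : realType) (V W : normedModType R) (f : V -> W) (m : nat)
  (c : 'I_m -> R) (v : 'I_m -> V) : linear f ->
  f (\sum_j c j *: v j) = \sum_j c j *: f (v j).
Proof.
move=> linf.
elim: m c v => [|m IH] c v; first by rewrite !big_ord0 linear_map0.
by rewrite !big_ord_recl linf IH.
Qed.

Lemma uniformly_bounding_R (R : realType) (W : normedModType R) :
  uniformly_bounding R W.
Proof.
move=> I T linT /(_ 1)[B HB]; exists (Num.max 0 B); first by rewrite le_max lexx.
move=> i v; have -> : T i v = v *: T i 1.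
  have := linT i v 1 0; rewrite (linear_map0 (linT i)) !addr0 => <-.
  by congr (T i _); rewrite /GRing.scale /= mulr1.
rewrite normrZ mulrC ler_wpM2r// (le_trans (HB i))// le_max lexx orbT //.
Qed.

Lemma uniformly_bounding_rV (R : realType) (m : nat) (W : normedModType R) :
  uniformly_bounding 'rV[R]_m W.
Proof.
move=> I T linT Tb.
have [B HB] := choice (fun j => Tb (delta_mx 0 j)).
exists (\sum_j `|B j|) => [|i v]; first exact: sumr_ge0.
rewrite {1}(row_sum_delta v) (linear_sumZ _ _ (linT i)).
apply: (le_trans (ler_norm_sum _ _ _)); rewrite mulr_suml ler_sum// => j _.
rewrite normrZ mulrC ler_pM// ?rV_norm_ge//.
exact/(le_trans (HB j i))/ler_norm.
Qed.

Lemma uniformly_bounding_prod (R : realType) (V1 V2 W : normedModType R) :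
  uniformly_bounding V1 W -> uniformly_bounding V2 W ->
  uniformly_bounding (V1 * V2)%type W.
Proof.
move=> b1 b2 I T linT Tb.
have [|v|K1 K1_ge0 HK1] := b1 I (fun i v => T i (v, 0)).
- move=> i a u v /=; rewrite -linT; congr (T i _).
  by rewrite [RHS]surjective_pairing /= scaler0 addr0.
- exact: Tb.
have [|v|K2 K2_ge0 HK2] := b2 I (fun i v => T i (0, v)).
- move=> i a u v /=; rewrite -linT; congr (T i _).
  by rewrite [RHS]surjective_pairing /= scaler0 addr0.
- exact: Tb.
exists (K1 + K2) => [|i [v1 v2]]; first exact: addr_ge0.
have -> : T i (v1, v2) = T i (v1, 0) + T i (0, v2).
  rewrite -[X in X + _]scale1r -linT; congr (T i _).
  by rewrite scale1r [RHS]surjective_pairing /= addr0 add0r.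
apply: (le_trans (ler_normD _ _)); rewrite mulrDl; apply: lerD.
  by apply: (le_trans (HK1 i v1)); rewrite ler_wpM2l// (norm_fst (v1, v2)).
by apply: (le_trans (HK2 i v2)); rewrite ler_wpM2l// (norm_snd (v1, v2)).
Qed.

(** A derivative sees only increments along a line. This reduces derivatives of the Hamiltonian on
    phase space to functions of fewer variables. *)
Lemma is_derive_increment (R : realType) (V V' W : normedModType R) (f : V -> W)
    (g : V' -> W) x v y w df :
  (forall h : R, f (h *: v + x) - f x = g (h *: w + y) - g y) ->
  is_derive x v f df -> is_derive y w g df.
Proof.
move=> fg; have E : (fun h : R => h^-1 *: ((f \o shift x) (h *: v) - f x)) =
    (fun h : R => h^-1 *: ((g \o shift y) (h *: w) - g y)).
  by apply/funext => h /=; rewrite fg.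
by move=> [d1 d2]; split; [move: d1|move: d2]; rewrite /derivable /derive E.
Qed.

Lemma derive_increment (R : realType) (V V' W : normedModType R) (f : V -> W)
    (g : V' -> W) x v y w :
  (forall h : R, f (h *: v + x) - f x = g (h *: w + y) - g y) ->
  'D_v f x = 'D_w g y.
Proof.
move=> fg; have E : (fun h : R => h^-1 *: ((f \o shift x) (h *: v) - f x)) =
    (fun h : R => h^-1 *: ((g \o shift y) (h *: w) - g y)).
  by apply/funext => h /=; rewrite fg.
by rewrite /derive E.
Qed.

(** The differentials, indexed by the points of [U], form a pointwise bounded family, hence have a
    common operator bound; the mean value inequality along segments of the convex set [U]
    concludes. *)
Lemma lipschitz_of_bounded_derive (R : realType) (V W : normedModType R)
    (U : set V) (f : V -> W) :
  uniformly_bounding V W ->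
  (forall x y t, U x -> U y -> 0 <= t <= 1 -> U (x + t *: (y - x))) ->
  (forall x, U x -> differentiable f x) ->
  (forall v, bounded_on U (fun x => 'D_v f x)) ->
  exists2 K, 0 <= K & forall x y, U x -> U y -> `|f x - f y| <= K * `|x - y|.
Proof.
move=> ubV cU df bf.
have [|v|K K0 HK] := ubV {x | U x} (fun x => 'd f (sval x)).
- by move=> [x Ux] a u v /=; rewrite linearP.
- have [B HB] := bf v; exists B => -[x Ux] /=.
  by rewrite -deriveE; [exact: HB|exact: df].
exists K => // x y Ux Uy.
have dg (t : R) : is_derive t (1 : R) (fun t => K * `|x - y| * t) (K * `|x - y|).
  by apply: is_derive_eq; rewrite /GRing.scale /= mulr1.
have du (t : R) : 0 <= t <= 1 ->
    is_derive t (1 : R) (fun t => f (x + t *: (y - x))) ('d f (x + t *: (y - x)) (y - x)).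
  move=> t01; have df' := df _ (cU _ _ _ Ux Uy t01).
  apply: (@is_derive_increment _ _ _ _ f _ (x + t *: (y - x)) (y - x)) => [h|].
    by rewrite [h%:A]mulr1 scalerDl addrCA.
  by split; [exact: diff_derivable | rewrite deriveE].
have := mvt_le_itv ler01 du (fun t _ => dg t).
rewrite scale1r scale0r addr0 mulr1 mulr0 subr0 [x + (_ - _)]addrC subrK [`|f y - _|]distrC.
apply => t t01; rewrite -(distrC y x).
exact: (HK (exist _ _ (cU _ _ _ Ux Uy t01))).
Qed.

Lemma Ck_continuous (R : realType) (V W : normedModType R) k (U : set V)
  (f : V -> W) x : Ck k U f -> U x -> {for x, continuous f}.
Proof.
case: k => [h /h //|k] [df _] Ux.
exact/differentiable_continuous/df.
Qed.

(** The slab [|eps| < eps0] is convex and the first derivatives are bounded on it, so [X1] is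
    Lipschitz jointly in phase, time and parameter. *)
Lemma X1_bounded_lipschitz (R : realType) (n d r : nat) (eps0 : R)
    (X1 : phase R n d -> R -> R -> phase R n d) :
  Ckb r.+1 [set w : phase R n d * R * R | `|w.2| < eps0]
    (fun w => X1 w.1.1 w.1.2 w.2) ->
  exists2 L, 0 <= L &
   (forall z t eps, `|eps| < eps0 -> `|X1 z t eps| <= L) /\
   (forall z z' t t' eps eps', `|eps| < eps0 -> `|eps'| < eps0 ->
    `|X1 z t eps - X1 z' t' eps'| <= L * `|(z, t, eps) - (z', t', eps')|).
Proof.
move=> [[B HB] [dX DX]].
have [|x y t|v|K K0 HK] := lipschitz_of_bounded_derive _ _ dX.
- do ![apply: uniformly_bounding_prod] => //; try exact: uniformly_bounding_R;
    exact: uniformly_bounding_rV.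
- rewrite /= !ltr_norml => /andP[x1 x2] /andP[y1 y2] /andP[t0 t1].
  rewrite -[t *: _]/(t * (y.2 - x.2)).
  have [xy|/ltW xy] := leP x.2 y.2.
    have : 0 <= t * (y.2 - x.2) by rewrite mulr_ge0// subr_ge0.
    have : 0 <= (1 - t) * (y.2 - x.2) by rewrite mulr_ge0// subr_ge0.
    by move=> *; apply/andP; lra.
  have : 0 <= t * (x.2 - y.2) by rewrite mulr_ge0// subr_ge0.
  have : 0 <= (1 - t) * (x.2 - y.2) by rewrite mulr_ge0// subr_ge0.
  by move=> *; apply/andP; lra.
- by have := DX v; case: r {DX} => [|r] [].
exists (Num.max K B); first by rewrite le_max K0.
split => [z t eps he|z z' t t' eps eps' he he'].
  by apply: (le_trans (HB (z, t, eps) he)); rewrite le_max lexx orbT.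
apply: (le_trans (HK (z, t, eps) (z', t', eps') he he')).
by rewrite ler_wpM2r// le_max lexx.
Qed.

(** * The rotator-pendulum field *)

Lemma periodic_add_int (R : realType) (T : Type) (f : R -> T) :
  (forall x, f (x + 1) = f x) -> forall x k, k \is a Num.int -> f (x + k) = f x.
Proof.
move=> per x k /intrP[m ->].
have perN y (N : nat) : f (y + N%:R) = f y.
  by elim: N => [|N IH]; rewrite ?addr0// -natr1 addrA per.
case: m => N; first exact: perN.
by rewrite NegzE mulrNz -[in RHS](subrK (N.+1%:R) x) perN.
Qed.

Lemma periodic_continuous_bounded (R : realType) (f : R -> R) :
  (forall x, f (x + 1) = f x) -> continuous f ->
  exists2 K, 0 <= K & forall x, `|f x| <= K.
Proof.
move=> per cf.
have [] := @EVT_max R (fun x => `|f x|) 0 1 ler01.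
  by apply: continuous_subspaceT => x; apply: cvg_norm; exact: cf.
move=> c _ Hc; exists `|f c| => // x.
have -> : f x = f (x - (Num.floor x)%:~R).
  by rewrite -[in LHS](subrK (Num.floor x)%:~R x) (periodic_add_int per)// intr_int.
apply: Hc; rewrite in_itv /= subr_ge0 Num.Theory.floor_le_tmp /=.
have := floorD1_gt x; rewrite intrD; lra.
Qed.

Lemma lipschitz_of_bounded_derive1 (R : realType) (f f' : R -> R) K :
  (forall x : R, is_derive x (1 : R) f (f' x)) -> (forall x, `|f' x| <= K) ->
  forall a b, `|f a - f b| <= K * `|a - b|.
Proof.
move=> df f'K.
have H a b : a <= b -> `|f a - f b| <= K * `|a - b|.
  move=> ab; rewrite distrC (distrC a) [`|b - a|]ger0_norm ?subr_ge0//.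
  have dg (t : R) : is_derive t (1 : R) (fun t => K * t) K.
    by apply: is_derive_eq; rewrite /GRing.scale /= mulr1.
  by rewrite mulrBr; apply: (mvt_le ab df dg).
move=> a b; case: (leP a b) => [|/ltW] /H //.
by rewrite distrC (distrC b).
Qed.

(** On a common ball each partial derivative is at most its norm at [x0] plus 1; directional
    derivatives are combinations of these, and the ball is convex. *)
Lemma locally_lipschitz (R : realType) (m : nat) (W : normedModType R)
    (f : 'rV[R]_m -> W) (x0 : 'rV[R]_m) :
  (forall x, differentiable f x) ->
  (forall j, continuous (fun x => 'D_(delta_mx 0 j) f x)) ->
  exists2 r1, 0 < r1 & exists2 K, 0 <= K & forall x y,
    `|x - x0| < r1 -> `|y - x0| < r1 -> `|f x - f y| <= K * `|x - y|.
Proof.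
move=> df cf.
have near_j (j : 'I_m) : \forall x \near x0,
    `|'D_(delta_mx 0 j) f x| < `|'D_(delta_mx 0 j) f x0| + 1.
  have /(_ (nbhs_filter x0)) := cvg_norm (cf j x0).
  by move=> /(@cvgr_lt _ _ _ (nbhs_filter x0)); apply; rewrite ltrDl.
have /nbhs_ballP[r1 /= r10 Hr1] := @filter_forall _ _ _ _ (nbhs_filter x0) near_j.
exists r1 => //.
have [||x _|v|K K0 HK] := @lipschitz_of_bounded_derive R 'rV[R]_m W
    [set x | `|x - x0| < r1] f.
- exact: uniformly_bounding_rV.
- move=> x y t /= hx hy /andP[t0 t1].
  rewrite (_ : _ - _ = (1 - t) *: (x - x0) + t *: (y - x0)); last first.
    apply/rowP => j; rewrite !mxE; ring.
  apply: (le_lt_trans (ler_normD _ _)); rewrite !normrZ ger0_norm ?subr_ge0//.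
  rewrite (ger0_norm t0); have [h|/ltW h] := leP `|x - x0| `|y - x0|.
    have : (1 - t) * `|x - x0| <= (1 - t) * `|y - x0| by rewrite ler_wpM2l// subr_ge0.
    lra.
  have : t * `|y - x0| <= t * `|x - x0| by rewrite ler_wpM2l.
  lra.
- exact: df.
- exists (\sum_j `|v 0 j| * (`|'D_(delta_mx 0 j) f x0| + 1)) => x /= hx.
  rewrite deriveE; last exact: df.
  rewrite {1}(row_sum_delta v) linear_sum.
  apply: (le_trans (ler_norm_sum _ _ _)); apply: ler_sum => j _.
  rewrite linearZ normrZ ler_wpM2l// ltW// -deriveE; last exact: df.
  by apply: Hr1; rewrite -ball_normE /ball_ /= distrC.
by exists K => // x y hx hy; exact: HK.
Qed.

Section rotator_pendulum.
Context (R : realType) (n d r : nat) (h0 : 'rV[R]_d -> R) (sg : 'I_n -> bool)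
  (V : 'I_n -> R -> R).
Hypothesis V_per : forall i x, V i (x + 1) = V i x.
Notation H := (rotator_pendulum h0 sg V).
Hypothesis H_smooth : Ck r.+2 setT H.

Lemma rotator_pendulum_periodic : periodic_on_M H.
Proof.
move=> z l [ml al pl _]; rewrite /rotator_pendulum.
rewrite -[act (z + l)]/(act z + act l) al addr0; congr (_ + _).
apply: eq_bigr => i _; rewrite -[mom (z + l)]/(mom z + mom l) ml addr0.
rewrite -[pos (z + l)]/(pos z + pos l) [(pos z + pos l) 0 i]mxE.
by rewrite (periodic_add_int (V_per i)).
Qed.

Lemma derive_ang j z : 'D_(@e_ang R n d j) H z = 0.
Proof.
rewrite (@derive_increment _ _ _ _ H (fun _ : R => 0 : R) z _ 0 1); last first.
  move=> h; rewrite subrr /rotator_pendulum.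
  rewrite -[act (_ + z)]/(h *: 0 + act z) -[mom (_ + z)]/(h *: 0 + mom z).
  by rewrite -[pos (_ + z)]/(h *: 0 + pos z) !scaler0 !add0r subrr.
exact: derive_cst.
Qed.

Lemma derive_mom i z : 'D_(@e_mom R n d i) H z = (-1) ^+ sg i * mom z 0 i.
Proof.
rewrite (@derive_increment _ _ _ _ H (fun p : R => (-1) ^+ sg i * (p ^+ 2 / 2))
  z _ (mom z 0 i) 1).
  have D : is_derive (mom z 0 i) (1 : R) (fun p : R => (-1) ^+ sg i * (p ^+ 2 / 2))
     ((-1) ^+ sg i * mom z 0 i).
    by apply: is_derive_eq; rewrite /GRing.scale /=; field.
  by case: D.
move=> h; rewrite /rotator_pendulum.
rewrite -[act (_ + z)]/(h *: 0 + act z) -[mom (_ + z)]/(h *: delta_mx 0 i + mom z).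
rewrite -[pos (_ + z)]/(h *: 0 + pos z) !scaler0 !add0r.
rewrite (bigD1 i)//= [in X in _ - X](bigD1 i)//= !mxE !eqxx /=.
rewrite (eq_bigr (fun j => (-1) ^+ sg j * (mom z 0 j ^+ 2 / 2 + V j (pos z 0 j)))).
  by rewrite [h%:A]mulr1 [h * _]mulr1; ring.
by move=> j ji; rewrite !mxE (negPf ji) andbF mulr0 add0r.
Qed.

Lemma pos_increment i z h : H (h *: @e_pos R n d i + z) - H z =
  (-1) ^+ sg i * (V i (h + pos z 0 i) - V i (pos z 0 i)).
Proof.
rewrite /rotator_pendulum.
rewrite -[act (_ + z)]/(h *: 0 + act z) -[pos (_ + z)]/(h *: delta_mx 0 i + pos z).
rewrite -[mom (_ + z)]/(h *: 0 + mom z) !scaler0 !add0r.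
rewrite (bigD1 i)//= [in X in _ - X](bigD1 i)//= !mxE !eqxx /=.
rewrite (eq_bigr (fun j => (-1) ^+ sg j * (mom z 0 j ^+ 2 / 2 + V j (pos z 0 j)))).
  by rewrite [h * _]mulr1; ring.
by move=> j ji; rewrite !mxE (negPf ji) andbF mulr0 add0r.
Qed.

(** Smoothness is assumed of [H], not of the separate [V i], so the force on [q_i] is kept as a
    derivative of [H], evaluated on the [q_i]-axis to become a function of one real variable. *)
Lemma derive_pos i z :
  'D_(@e_pos R n d i) H z = 'D_(@e_pos R n d i) H (pos z 0 i *: @e_pos R n d i).
Proof.
apply: derive_increment => h; rewrite !pos_increment.
rewrite -[pos (_ *: _)]/(pos z 0 i *: delta_mx 0 i).
by rewrite !mxE !eqxx mulr1.
Qed.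

Lemma derive_act j z :
  'D_(@e_act R n d j) H z = 'D_(@e_act R n d j) H ((0, 0), (act z, 0)).
Proof.
apply: derive_increment => h; rewrite /rotator_pendulum.
rewrite -![act (_ *: _ + _)]/(h *: delta_mx 0 j + _).
rewrite -![mom (_ *: _ + _)]/(h *: 0 + _) -![pos (_ *: _ + _)]/(h *: 0 + _).
rewrite !scaler0 !add0r -[act (_, _)]/(act z) /mom /pos /=; ring.
Qed.

(** On the [q_i]-axis the force [W i] is 1-periodic and C^1; its derivative is periodic and
    continuous, hence bounded, which makes the Lipschitz constant global. *)
Lemma pos_field_lipschitz : exists2 K, 0 <= K & forall i z z',
  `|'D_(@e_pos R n d i) H z - 'D_(@e_pos R n d i) H z'| <=
  K * `|pos z 0 i - pos z' 0 i|.
Proof.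
have [_ D1] := H_smooth.
pose W i (x : R) := 'D_(@e_pos R n d i) H (x *: @e_pos R n d i).
pose W' i (x : R) :=
  'D_(@e_pos R n d i) (fun z => 'D_(@e_pos R n d i) H z) (x *: @e_pos R n d i).
have dW i (x : R) : is_derive x (1 : R) (W i) (W' i x).
  have [d2 _] := D1 (@e_pos R n d i).
  apply: (@is_derive_increment _ _ _ _ (fun z => 'D_(@e_pos R n d i) H z) (W i)
    (x *: @e_pos R n d i) (@e_pos R n d i)).
    by move=> h; rewrite /W [h%:A]mulr1 scalerDl.
  by split => //; apply: diff_derivable; exact: d2.
have W1 i x : W i (x + 1) = W i x.
  apply: derive_increment => h; rewrite !pos_increment.
  rewrite -![pos (_ *: _)]/(_ *: delta_mx 0 i).
  by rewrite !mxE !eqxx !mulr1 addrA !V_per.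
have W'1 i x : W' i (x + 1) = W' i x.
  apply: derive_increment => h; rewrite -!scalerDl addrA.
  by rewrite -![X in X - _ = _]/(W i _) -![X in _ = X - _]/(W i _)
    -![X in _ - X = _]/(W i _) -![X in _ = _ - X]/(W i _) !W1.
have cW' i : continuous (W' i).
  move=> x; have [_ D2] := D1 (@e_pos R n d i).
  apply: (@continuous_comp _ _ _ (fun x : R => x *: @e_pos R n d i)
    (fun z => 'D_(@e_pos R n d i) (fun z => 'D_(@e_pos R n d i) H z) z)).
    exact: scalel_continuous.
  exact: (Ck_continuous (D2 _)).
have bW i : exists K, 0 <= K /\ forall x, `|W' i x| <= K.
  by have [K K0 HK] := periodic_continuous_bounded (W'1 i) (cW' i); exists K.
have [K HK] := choice bW.
exists (\sum_i K i) => [|i z z']; first by apply: sumr_ge0 => i _; case: (HK i).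
rewrite derive_pos [in X in _ - X]derive_pos.
have [Ki0 Ki] := HK i.
apply: (le_trans (lipschitz_of_bounded_derive1 (dW i) Ki _ _)).
rewrite ler_wpM2r// (bigD1 i)//= lerDl sumr_ge0// => j _.
by case: (HK j).
Qed.

Lemma act_field_lipschitz (I0 : 'rV[R]_d) : exists2 r1, 0 < r1 &
  exists2 K, 0 <= K & forall j z z', `|act z - I0| < r1 -> `|act z' - I0| < r1 ->
  `|'D_(@e_act R n d j) H z - 'D_(@e_act R n d j) H z'| <= K * `|act z - act z'|.
Proof.
have [_ D1] := H_smooth.
pose iota (x : 'rV[R]_d) : phase R n d := ((0, 0), (x, 0)).
pose f j x := 'D_(@e_act R n d j) H (iota x).
have iota_line (k : 'I_d) (h : R) x :
    iota (h *: delta_mx 0 k + x) = h *: @e_act R n d k + iota x.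
  rewrite -[RHS]/((h *: 0 + 0, h *: 0 + 0), (h *: delta_mx 0 k + x, h *: 0 + 0)).
  by rewrite !scaler0 !addr0.
have d_iota y : differentiable iota y.
  have d1 : differentiable (fun x : 'rV[R]_d => (x, 0 : 'rV[R]_d)) y.
    by apply: (@differentiable_pair _ _ _ _ id (fun _ => 0)).
  exact: (@differentiable_pair _ _ _ _ (fun _ => (0 : 'rV[R]_n, 0 : 'rV[R]_n)) _ _ _ d1).
have f_lip j : exists p : R * R, 0 < p.1 /\ 0 <= p.2 /\ forall x y,
    `|x - I0| < p.1 -> `|y - I0| < p.1 -> `|f j x - f j y| <= p.2 * `|x - y|.
  have [d2 D2] := D1 (@e_act R n d j).
  have [x|k|r1 r10 [K K0 HK]] := @locally_lipschitz R d R (f j) I0.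
  - exact: (@differentiable_comp _ _ _ _ iota (fun z => 'D_(@e_act R n d j) H z) x (d_iota x) (d2 _ I)).
  - rewrite (_ : (fun x => _) = (fun z => 'D_(@e_act R n d k)
        (fun z => 'D_(@e_act R n d j) H z) z) \o iota); last first.
      apply/funext => x; apply: derive_increment => h.
      by rewrite /f iota_line.
    move=> x; apply: continuous_comp; last exact: (Ck_continuous (D2 _)).
    exact: differentiable_continuous.
  by exists (r1, K).
have [p Hp] := choice f_lip.
have [r1 r10 Hr1] : exists2 r1 : R, 0 < r1 & forall j, r1 <= (p j).1.
  (* The default value 1 keeps the radius positive when [d = 0]. *)
  exists (\big[Num.min/1]_j (p j).1).
    by apply: lt_bigmin => // j _; case: (Hp j).
  by move=> j; exact: bigmin_le.
exists r1 => //; exists (\sum_j (p j).2) => [|j z z' hz hz'].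
  by apply: sumr_ge0 => j _; case: (Hp j) => _ [].
rewrite derive_act [in X in _ - X]derive_act.
have [_ [K0 HK]] := Hp j.
apply: (le_trans (HK _ _ (lt_le_trans hz (Hr1 j)) (lt_le_trans hz' (Hr1 j)))).
rewrite ler_wpM2r// (bigD1 j)//= lerDl sumr_ge0// => k _.
by case: (Hp k) => _ [].
Qed.

End rotator_pendulum.

Lemma rotator_pendulum_tame (R : realType) (n d r : nat) (h0 : 'rV[R]_d -> R)
    (sg : 'I_n -> bool) (V : 'I_n -> R -> R) (eps0 : R)
    (X1 : phase R n d -> R -> R -> phase R n d) (I0 : 'rV[R]_d) :
  (forall i x, V i (x + 1) = V i x) ->
  Ck r.+2 setT (rotator_pendulum h0 sg V) ->
  (forall t eps, periodic_on_M (fun z => X1 z t eps)) ->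
  Ckb r.+1 [set w : phase R n d * R * R | `|w.2| < eps0]
    (fun w => X1 w.1.1 w.1.2 w.2) ->
  exists2 r1, 0 < r1 & exists L B,
    tame_system (ham_field (rotator_pendulum h0 sg V)) X1 eps0 I0 r1 L B.
Proof.
move=> V_per Hs Xper Xs; set H := rotator_pendulum _ _ _ in Hs *.
have [L1 L1_ge0 [Xb Xl]] := X1_bounded_lipschitz Xs.
have [K K0 HK] := pos_field_lipschitz V_per Hs.
have [r1 r10 [K' K'0 HK']] := act_field_lipschitz Hs I0.
have angK' z z' : `|act z - I0| < r1 -> `|act z' - I0| < r1 ->
    `|ang (ham_field H z) - ang (ham_field H z')| <= K' * `|act z - act z'|.
  move=> hz hz'; apply: rV_norm_le => [|j]; first by rewrite mulr_ge0.
  by rewrite !mxE; exact: HK'.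
(* In the Lipschitz constant, [K] serves the forces, [K'] the frequencies, [L1] the perturbation,
   and 1 the velocities of [q], which are the momenta up to sign. *)
exists r1 => //; exists (K + K' + L1 + 1), L1; split => //.
- by rewrite !addr_ge0.
- move=> z; apply/rowP => j; rewrite !mxE derive_ang oppr0 //.
- have Hp : periodic_on_M H := rotator_pendulum_periodic h0 sg V_per.
  move=> z l hl.
  have DH v : 'D_v H (z + l) = 'D_v H z.
    by apply: derive_increment => h; rewrite addrA !(Hp _ l hl).
  by rewrite /ham_field; congr ((_, _), (_, _)); apply/rowP => j; rewrite !mxE DH.
- move=> z z' hz hz'.
  have z_ge0 : 0 <= `|z - z'| by [].
  have le_coef (c : R) : c <= K + K' + L1 + 1 ->
      c * `|z - z'| <= (K + K' + L1 + 1) * `|z - z'| by move=> ?; rewrite ler_wpM2r.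
  have bound_ge0 : 0 <= (K + K' + L1 + 1) * `|z - z'|.
    by rewrite mulr_ge0// !addr_ge0.
  rewrite !pair_norm_le; apply/andP; split; apply/andP; split.
  + apply: rV_norm_le => // i; rewrite !mxE -opprD normrN.
    apply: (le_trans (HK _ _ _)); apply: le_trans (le_coef K _); last lra.
    rewrite ler_wpM2l//.
    rewrite (_ : _ - _ = (pos (z - z')) 0 i); last by rewrite !mxE.
    apply: (le_trans (rV_norm_ge _ _)).
    exact: (le_trans (norm_snd (z - z').1) (norm_fst _)).
  + apply: rV_norm_le => // i; rewrite !mxE !derive_mom -mulrBr normrM normr_sign mul1r.
    apply: (@le_trans _ _ (1 * `|z - z'|)); last by apply: le_coef; lra.
    rewrite mul1r (_ : _ - _ = (mom (z - z')) 0 i); last by rewrite !mxE.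
    apply: (le_trans (rV_norm_ge _ _)).
    exact: (le_trans (norm_fst (z - z').1) (norm_fst _)).
  + apply: rV_norm_le => // i; rewrite !mxE !derive_ang subrr normr0 //.
  + apply: (le_trans (angK' _ _ hz hz')).
    apply: (@le_trans _ _ (K' * `|z - z'|)); last by apply: le_coef; lra.
    by rewrite ler_wpM2l//; exact: (norm_act (z - z')).
- move=> z z' hz hz'; apply: (le_trans (angK' _ _ hz hz')).
  by rewrite ler_wpM2r//; lra.
- move=> z z' t t' eps eps' he he'; apply: (le_trans (Xl _ _ _ _ _ _ he he')).
  by rewrite ler_wpM2r//; lra.
Qed.

(** * Integrals of exponentially decaying functions *)

Section exponential_decay.
Context (R : realType) (K c : R).
Hypotheses (K_ge0 : 0 <= K) (c_gt0 : 0 < c).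
Let mu := @lebesgue_measure R.

Definition envelope (s : R) := K * expR (- c * `|s|).

Lemma envelope_ge0 s : 0 <= envelope s.
Proof. by rewrite mulr_ge0 ?expR_ge0. Qed.

Lemma envelope_continuous : continuous envelope.
Proof.
move=> s; apply: cvgMr; apply: continuous_comp; last exact: continuous_expR.
by apply: cvgMr; apply: cvg_norm; exact: cvg_id.
Qed.

Lemma integral_envelope (T : R) : 0 <= T ->
  (\int[mu]_(x in `[T, +oo[) (envelope x)%:E = (K / c * expR (- c * T))%:E)%E.
Proof.
move=> T0; pose F (s : R) := - (K / c) * expR (s * - c).
have dF (x : R) := is_derive_exp (- (K / c)) (- c) x.
rewrite (@ge0_continuous_FTC2y _ _ F T 0).
- by rewrite /F -EFinB sub0r mulNr opprK [T * _]mulrC.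
- by move=> x _; exact: envelope_ge0.
- by apply: continuous_subspaceT => x; exact: envelope_continuous.
- rewrite -[X in _ --> X](mulr0 (- (K / c))); apply: cvgMr.
  rewrite (_ : (fun x : R => _) = (fun x : R => expR (- x)) \o (fun x => x * c)).
    apply: cvg_comp; last exact: cvgr_expR.
    exact: gt0_cvgMly.
  by apply/funext => x /=; rewrite mulrN.
- by move=> x _; case: (dF x).
- apply: cvg_at_right_filter; apply/differentiable_continuous/derivable1_diffP.
  by case: (dF T).
- move=> x; rewrite in_itv /= andbT => Tx.
  rewrite derive1E; case: (dF x) => _ ->.
  rewrite /envelope ger0_norm ?(le_trans T0 (ltW Tx))// [x * _]mulrC.
  by field; rewrite gt_eqF.
Qed.

Lemma integrable_envelope : mu.-integrable setT (EFin \o envelope).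
Proof.
apply/integrableP; split.
  by apply/measurable_EFinP; apply: continuous_measurable_fun; exact: envelope_continuous.
under eq_integral do rewrite /= ger0_norm ?envelope_ge0//.
rewrite ge0_symfun_integralT.
- by rewrite -set_itvcy integral_envelope// -EFinM ltry.
- exact: envelope_ge0.
- exact: envelope_continuous.
- by move=> x; rewrite /envelope /= normrN.
Qed.

Variable G : R -> R.
Hypotheses (G_continuous : continuous G) (G_le : forall s, `|G s| <= envelope s).

Lemma integrable_decay : mu.-integrable setT (EFin \o G).
Proof.
apply: le_integrable integrable_envelope => //.
  by apply/measurable_EFinP; exact: continuous_measurable_fun.
by move=> x _ /=; rewrite lee_fin (ger0_norm (envelope_ge0 x)).
Qed.

Let integrable_sub (f : R -> R) (A : set (measurableTypeR R)) : measurable A ->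
  mu.-integrable setT (EFin \o f) -> mu.-integrable A (EFin \o f).
Proof. by move=> mA; apply: integrableS. Qed.

(** The primitive is the integral from minus infinity. Each of the two tails cut off at [T] and
    [- T] is bounded by the corresponding tail of the envelope. *)
Lemma decay_primitive : exists P : R -> R,
  (forall s : R, is_derive s (1 : R) P (G s)) /\
  forall T, 0 <= T -> `|\int[mu]_x G x - (P T - P (- T))| <=
    2 * (K / c * expR (- c * T)).
Proof.
pose P (s : R) := \int[mu]_(x in `]-oo, s]) G x.
have iG (A : set (measurableTypeR R)) : measurable A -> mu.-integrable A (EFin \o G).
  by move=> mA; apply: integrable_sub integrable_decay.
have iE (A : set (measurableTypeR R)) : measurable A -> mu.-integrable A (EFin \o envelope).
  by move=> mA; apply: integrable_sub integrable_envelope.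
exists P; split.
  move=> s.
  have s1 : s < s + 1 by rewrite ltrDl.
  have mi : measurable [set` Interval -oo%O (BRight (s + 1))] by [].
  have [dP vP] := continuous_FTC1 s1 (iG _ mi) (ltNyr s) (@G_continuous s).
  by split; [exact: dP | rewrite -derive1E].
move=> T T0.
have tail (A : set (measurableTypeR R)) : measurable A ->
    `|\int[mu]_(x in A) G x| <= \int[mu]_(x in A) envelope x.
  move=> mA; have h := le_normr_Rintegral mA (iG _ mA).
  apply: (le_trans h).
  apply: le_Rintegral => //; last exact: iE.
  by apply: (integrable_norm (iG _ mA)).
have right_tail : `|\int[mu]_x G x - P T| <= K / c * expR (- c * T).
  rewrite /P -set_itvNyy Rintegral_itvB//; last by apply: iG.
  apply: (le_trans (tail _ _)) => //.
  rewrite Rintegral_itv_obnd_cbnd; last exact: iE.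
  by rewrite /Rintegral integral_envelope.
(* The envelope is even, so reflection reduces the left tail to the right one. *)
have left_tail : `|P (- T)| <= K / c * expR (- c * T).
  apply: (le_trans (tail _ _)) => //.
  rewrite /Rintegral ge0_integration_by_substitutionNy.
  - rewrite (_ : envelope \o -%R = envelope) ?integral_envelope//.
    by apply/funext => x; rewrite /envelope /= normrN.
  - by apply: continuous_subspaceT => x; exact: envelope_continuous.
  - by move=> x _; exact: envelope_ge0.
rewrite opprB addrCA addrC; apply: (le_trans (ler_normD _ _)); lra.
Qed.

End exponential_decay.

(** * One half of the Melnikov formula *)

(** For eps = 0 pendulums and rotators decouple, and this is the foot point of a homoclinic point,
    for the stable and the unstable fibers alike, up to the lattice. *)
Definition cylinder_proj (R : realType) (n d : nat) (w : ext_phase R n d) :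
    ext_phase R n d := ((0, 0, (act w.1, ang w.1)), w.2).

Section cylinder_proj.
Context (R : realType) (n d : nat).
Implicit Types w l : ext_phase R n d.

Lemma cylinder_projB w l :
  cylinder_proj (w - l) = cylinder_proj w - cylinder_proj l.
Proof.
rewrite -[RHS]/((0 - 0, 0 - 0, (act w.1 - act l.1, ang w.1 - ang l.1)), w.2 - l.2).
by rewrite subrr.
Qed.

Lemma norm_cylinder_proj w : `|cylinder_proj w| <= `|w|.
Proof.
have h1 : `|w.1.2| <= `|w| := le_trans (norm_snd w.1) (norm_fst w).
rewrite !pair_norm_le /= !normr0 normr_ge0 norm_snd.
by rewrite (le_trans (norm_fst _) h1) (le_trans (norm_snd _) h1).
Qed.

Lemma cylinder_proj_lattice l : ext_lattice l -> ext_lattice (cylinder_proj l).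
Proof.
move=> [[ml al pl tl] l2]; split => //; split => //.
by move=> i; rewrite /pos /= mxE.
Qed.

(** If [x] differs from an integer within 1/2 of it, a strictly closer integer exists; the two are
    less than 1 apart, hence equal, a contradiction. *)
Lemma int_closed (x : R) :
  (forall e, 0 < e -> exists2 k, k \is a Num.int & `|x - k| < e) -> x \is a Num.int.
Proof.
move=> h; have [|k ki hk] := h 2^-1; first by rewrite invr_gt0.
have [->//|xk] := eqVneq x k.
have [|k' ki' hk'] := h `|x - k|; first by rewrite normr_gt0 subr_eq0.
have /intrP[m km] : k - k' \is a Num.int by rewrite rpredB.
have : `|k - k'| < 1.
  have -> : k - k' = (x - k') - (x - k) by rewrite opprB [RHS]addrC subrKA.
  by apply: (le_lt_trans (ler_normB _ _)); lra.
rewrite km -intr_norm -[1]/(1%:~R) ltr_int => hm.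
have m0 : m = 0 by lia.
by move: km hk'; rewrite m0 => /subr0_eq ->; rewrite ltxx.
Qed.

(** The nearly optimal lattice vector varies with the tolerance, so the limit rests on the
    closedness of the integers in each angular coordinate. *)
Lemma eqM_of_distM w w' : (forall e, 0 < e -> distM w w' < e) -> eqM w w'.
Proof.
move=> h; rewrite /eqM.
have close e : 0 < e -> exists2 l, ext_lattice l & `|w - w' - l| < e.
  by move=> e0; apply: distM_adherent; exact: h.
have zero (V : normedModType R) (v : V) : (forall e, 0 < e -> `|v| < e) -> v = 0.
  move=> hv; apply/eqP; rewrite -normr_eq0 eq_le normr_ge0 andbT.
  by rewrite leNgt; apply/negP => /hv; rewrite ltxx.
have [n1 n2 n3 n4] : [/\ forall v : ext_phase R n d, `|mom v.1| <= `|v|,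
    forall v : ext_phase R n d, `|act v.1| <= `|v|,
    forall v : ext_phase R n d, `|pos v.1| <= `|v| &
    forall v : ext_phase R n d, `|ang v.1| <= `|v|].
  split=> v.
  - exact: le_trans (le_trans (norm_fst v.1.1) (norm_fst v.1)) (norm_fst v).
  - exact: le_trans (norm_act v.1) (norm_fst v).
  - exact: le_trans (le_trans (norm_snd v.1.1) (norm_fst v.1)) (norm_fst v).
  - exact: le_trans (norm_ang v.1) (norm_fst v).
split; last first.
  apply: (zero R^o) => e /close[l [_ l2] hl]; apply: le_lt_trans hl.
  by have := norm_snd (w - w' - l); rewrite /= l2 subr0.
split.
- apply: zero => e /close[l [[ml _ _ _] _] hl]; apply: le_lt_trans hl.
  by have := n1 (w - w' - l); rewrite /= -[mom _]/(mom (w - w').1 - mom l.1) ml subr0.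
- apply: zero => e /close[l [[_ al _ _] _] hl]; apply: le_lt_trans hl.
  by have := n2 (w - w' - l); rewrite /= -[act _]/(act (w - w').1 - act l.1) al subr0.
- move=> j; apply: int_closed => e /close[l [[_ _ pl _] _] hl].
  exists (pos l.1 0 j) => //; apply: le_lt_trans hl.
  apply: le_trans (n3 (w - w' - l)); apply: le_trans (rV_norm_ge _ j).
  by rewrite -[pos (_ - l).1]/(pos (w - w').1 - pos l.1) !mxE.
- move=> j; apply: int_closed => e /close[l [[_ _ _ tl] _] hl].
  exists (ang l.1 0 j) => //; apply: le_lt_trans hl.
  apply: le_trans (n4 (w - w' - l)); apply: le_trans (rV_norm_ge _ j).
  by rewrite -[ang (_ - l).1]/(ang (w - w').1 - ang l.1) !mxE.
Qed.

End cylinder_proj.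

(** First the foot point is located at scale eps with the horizon [T1], then the Melnikov comparison
    runs up to [T]. In [M] the terms stem from the displacement of the cylinder ([K0]), the action
    and angle gaps, the tail at [T1] ([C + 1]), and the displacement of the homoclinic point
    ([kz]). *)
Lemma half_expansion (R : realType) (n d : nat)
    (X0 : phase R n d -> phase R n d) (X1 : phase R n d -> R -> R -> phase R n d)
    (eps0 : R) (I0 : 'rV[R]_d) (r1 L B sg eps c C T T1 kz K0 : R)
    (x y x0 y0 : R -> ext_phase R n d) (lx l' : ext_phase R n d) (b : base R d)
    (A : R -> 'rV[R]_d) :
  let K1 := L * C / c in
  let M := K0 + K1 + L * (K1 + C) / c + (C + 1) + kz in
  tame_system X0 X1 eps0 I0 r1 L B -> `|sg| = 1 -> `|eps| < eps0 ->
  0 < c -> 0 <= T -> 0 <= T1 -> 0 <= K0 -> 0 <= kz ->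
  orbit_of (ext_field X0 X1 eps) sg x -> orbit_of (ext_field X0 X1 eps) sg y ->
  orbit_of (ext_field X0 X1 0) sg x0 -> orbit_of (ext_field X0 X1 0) sg y0 ->
  (forall s, 0 <= s -> distM (x s) (y s) <= C * expR (s * - c)) ->
  ext_lattice lx -> `|x 0 - x0 0 - lx| <= kz * `|eps| ->
  ext_lattice l' ->
  `|y 0 - l' - (((0, 0), (b.1.1, b.1.2)), b.2 : R)| <= K0 * `|eps| ->
  eqM (y0 0) (cylinder_proj (x0 0)) -> act (x0 0).1 = I0 ->
  expR (T1 * - c) <= `|eps| ->
  (kz + 2 * K1) * `|eps| + `|eps| * (B * T) < r1 ->
  (kz + 2 * K1) * `|eps| + `|eps| * (B * T1) < r1 ->
  (forall s : R, is_derive s (1 : R) A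
     (act (X1 (y0 s).1 (y0 s).2 0) - act (X1 (x0 s).1 (x0 s).2 0))) ->
  `|act (y 0).1 - act (x 0).1 + (sg * eps) *: (A T - A 0)| <=
  `|eps| * (K1 * expR (T * - c) +
            2 * ((M + B + 1) * `|eps|) * expR ((L + 1) * T)).
Proof.
move=> K1 M tame sg1 he c0 T0 T10 K00 kz0 ox oy ox0 oy0 dxy hlx hx hl' hy e0 aI0
  hT1 nearT nearT1 dA.
have L0 := tame_L tame; have B0 := tame_B tame.
have C0 : 0 <= C.
  by have := dxy 0 (lexx 0); rewrite mul0r expR0 mulr1; exact/le_trans/distM_ge0.
have K10 : 0 <= K1 by rewrite /K1 divr_ge0 ?mulr_ge0// ltW.
have c1 : - c < 0 by rewrite oppr_lt0.
have E0 : 0 <= `|eps| by [].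
have KE : 0 <= K1 * `|eps| by rewrite mulr_ge0.
have M1_ge0 : 0 <= L * (K1 + C) / c by rewrite divr_ge0 ?mulr_ge0 ?addr_ge0// ltW.
have BT : 0 <= `|eps| * (B * T) by rewrite !mulr_ge0.
have BT1 : 0 <= `|eps| * (B * T1) by rewrite !mulr_ge0.
have ax : `|act (x 0).1 - I0| <= kz * `|eps|.
  rewrite -aI0 (le_trans (norm_actB_distM _ _))// (le_trans _ hx)//.
  exact: distM_le.
have ay : `|act (y 0).1 - I0| <= (kz + K1) * `|eps|.
  have := act_diff_le tame sg1 he c1 ox oy dxy (lexx 0).
  rewrite mul0r expR0 mulr1 opprK -/K1.
  rewrite -[act (y 0).1 - I0](subrKA (act (x 0).1)) => h.
  by apply: (le_trans (ler_normD _ _)); lra.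
have [l hl] : exists2 l, ext_lattice l &
    `|y 0 - cylinder_proj (x 0) - l| <=
    (K0 + K1 + L * (K1 + C) / c) * `|eps| + (C + 1) * expR (T1 * - c).
  have near1 : `|act (x 0).1 - I0| + `|eps| * (B * T1 + L * C / - - c) < r1.
    by rewrite opprK -/K1 mulrDr; lra.
  have := foot_close tame sg1 he c1 ox oy dxy T10 near1 hl' hy.
  by rewrite opprK.
have C1e : (C + 1) * expR (T1 * - c) <= (C + 1) * `|eps|.
  by rewrite ler_wpM2l// addr_ge0.
move=> hyl.
(* Three lattice vectors add up: from [y] to the projection of [x], from there to the projection of
   [x0], and on to [y0]. *)
have hy0 : `|y 0 - y0 0 -
    (l + cylinder_proj lx - (y0 0 - cylinder_proj (x0 0)))| <= M * `|eps|.
  have -> : y 0 - y0 0 - (l + cylinder_proj lx - (y0 0 - cylinder_proj (x0 0))) =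
      (y 0 - cylinder_proj (x 0) - l) + cylinder_proj (x 0 - x0 0 - lx).
    rewrite !cylinder_projB opprB -[y0 0 - cylinder_proj _ - _]addrA subrKA.
    rewrite [y 0 - cylinder_proj _ - l]addrAC -[_ - cylinder_proj lx]addrA subrKA.
    by rewrite opprD [_ + (- l - _)]addrCA !addrA.
  apply: (le_trans (ler_normD _ _)).
  have := norm_cylinder_proj (x 0 - x0 0 - lx).
  rewrite /M !mulrDl; lra.
have a0 : act (y0 0).1 = I0.
  have [[_ + _ _] _] := e0; rewrite -[act _]/(act (y0 0).1 - act (x0 0).1) aI0.
  exact: subr0_eq.
have r10 : 0 < r1 by apply: le_lt_trans nearT; rewrite addr_ge0// mulr_ge0// addr_ge0// mulr_ge0.
have kzM : kz * `|eps| <= M * `|eps|.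
  by rewrite ler_wpM2r// /M lerDr !addr_ge0.
have Me : 0 <= M * `|eps| by apply: le_trans kzM; rewrite mulr_ge0.
have hly : ext_lattice (l + cylinder_proj lx - (y0 0 - cylinder_proj (x0 0))).
  apply: ext_latticeB; last exact: e0.
  by apply: ext_latticeD => //; exact: cylinder_proj_lattice.
have := @half_melnikov _ _ _ _ _ _ _ _ _ _ tame _ sg1 eps (- c) C x y x0 y0 lx _
  (M * `|eps|) T A he c1 T0 Me ox oy ox0 oy0 dxy hlx hly (le_trans hx kzM) hy0.
rewrite a0 aI0 subrr normr0 opprK -/K1 => H.
have -> : (M + B + 1) * `|eps| = M * `|eps| + `|eps| * (B + 1) by ring.
apply: H => //; last first.
  by apply: le_lt_trans nearT; rewrite lerD2r (le_trans ay)// mulrDl; lra.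
by apply: le_lt_trans nearT; rewrite lerD2r (le_trans ax)// mulrDl lerDl; lra.
Qed.

(** * The scattering map *)

Lemma derive_linear (R : realType) (V W : normedModType R) (f : V -> W) x v :
  linear f -> 'D_v f x = f v.
Proof.
move=> linf; rewrite /derive; apply: cvg_lim => //; apply: cvg_near_cst.
have : \forall h \near (0 : R)^', h != 0 := nbhs_dnbhs_neq (0 : R).
apply: filterS => h h0 /=.
by rewrite linf addrK scalerA mulVf// scale1r.
Qed.

Lemma lie_act (R : realType) (n d : nat) (X : phase R n d -> phase R n d) z :
  lie X (@act R n d) z = act (X z).
Proof.
have Dact v : 'D_v (@act R n d) z = act v by exact: derive_linear.
rewrite /lie big1 ?add0r => [|i _]; last by rewrite !Dact !scaler0 addr0.
rewrite [RHS]row_sum_delta; apply: eq_bigr => j _.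
by rewrite !Dact scaler0 addr0.
Qed.

(** Identifies the bracket with the action component of the Hamiltonian field, so that the
    Hamiltonian formula becomes an instance of the general one. *)
Lemma vpoisson_act (R : realType) (n d : nat) (H : phase R n d -> R) z :
  vpoisson (@act R n d) H z = act (ham_field H z).
Proof.
apply/rowP => j; rewrite !mxE /poisson.
have Dact v : 'D_v (fun y : phase R n d => act y 0 j) z = act v 0 j.
  by apply: (@derive_linear _ _ _ (fun y : phase R n d => act y 0 j)) => a u w;
    rewrite /act /= !mxE.
have zero_terms (a b : R) : 0 * a - 0 * b = 0 by rewrite !mul0r subr0.
have ang_term (a b : R) : 0 * a - 1%:R * b = - b by rewrite mul0r sub0r mul1r.
have act_pos i : act (@e_pos R n d i) = 0 by [].
have act_mom i : act (@e_mom R n d i) = 0 by [].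
rewrite [X in X + _]big1 ?add0r => [|i _]; last first.
  by rewrite !Dact act_pos act_mom mxE; exact: zero_terms.
have act_ang k : act (@e_ang R n d k) = 0 by [].
have act_act k : act (@e_act R n d k) = delta_mx 0 k by [].
rewrite (bigD1 j)//= [X in _ + X]big1 ?addr0 => [|k kj]; rewrite !Dact act_ang act_act.
  by rewrite !mxE !eqxx; exact: ang_term.
by rewrite !mxE eq_sym (negPf kj) andbF; exact: zero_terms.
Qed.

Lemma is_derive_row (R : realType) (m : nat) (P : 'I_m -> R -> R)
    (G : R -> 'rV[R]_m) (s : R) :
  (forall j, is_derive s (1 : R) (P j) (G s 0 j)) ->
  is_derive s (1 : R) (fun t => \row_j P j t) (G s).
Proof.
move=> dP.
have PE j : (fun t => (\row_j P j t) (0 : 'I_1) j) = P j.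
  by apply/funext => t; rewrite mxE.
have dr : derivable (fun t => \row_j P j t) s 1.
  by apply/derivable_mxP => i j; rewrite (ord1 i) PE; case: (dP j).
split => //; rewrite derive_mx//; apply/rowP => j; rewrite mxE PE.
by case: (dP j).
Qed.

(* Compromise between the tails [exp (- D T)] and the Gronwall factor
   [exp ((L + 1) T)]: [T] is a multiple of [ln (1 / a)]. *)
Lemma time_scales (R : realType) (D L k B r1 : R) :
  0 < D -> 0 <= L -> 0 <= k -> 0 <= B -> 0 < r1 ->
  exists2 rho : R, 0 < rho < 1 & exists2 del : R, 0 < del & forall a, 0 < a < del ->
  exists T T1, [/\ 0 <= T, 0 <= T1, expR (T1 * - D) <= a &
    [/\ expR (T * - D) <= a `^ rho, a * expR ((L + 1) * T) <= a `^ rho,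
     k * a + a * (B * T) < r1 & k * a + a * (B * T1) < r1]].
Proof.
move=> D0 L0 k0 B0 r10.
have L1 : 0 < L + 1 by lra.
(* With T = - ln a / (2 (L + 1)), [a * expR ((L + 1) * T)] is a^(1/2) and [expR (T * - D)] is a^(D /
   (2 (L + 1))); [rho] is the smaller exponent. *)
pose rho := Num.min 2^-1 (D / (2 * (L + 1))).
have rho0 : 0 < rho by rewrite lt_min invr_gt0 ltr0n divr_gt0// mulr_gt0.
have rho2 : rho <= 2^-1 by rewrite ge_min lexx.
exists rho; first by rewrite rho0 /=; lra.
(* Both smallness conditions are bounded by [N] times the square root [q] of [a]; the added 1 makes
   [N] positive. *)
pose N := k + B * (1 / (L + 1)) + B * (2 / D) + 1.
have N1 : 0 <= B * (1 / (L + 1)) by rewrite mulr_ge0// divr_ge0// ltW.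
have N2 : 0 <= B * (2 / D) by rewrite mulr_ge0// divr_ge0// ltW.
have N0 : 0 < N by rewrite /N; lra.
pose eta := Num.min 1 (r1 / N).
have eta0 : 0 < eta by rewrite lt_min ltr01 divr_gt0.
exists (eta ^+ 2); first by rewrite exprn_gt0.
move=> a /andP[a0 aeta].
have eta1 : eta <= 1 by rewrite ge_min lexx.
have a1 : a < 1 by rewrite (lt_le_trans aeta)// expr_le1// ltW.
pose lam := ln a.
have aE : expR lam = a by rewrite lnK.
have lam0 : lam < 0 by rewrite ln_lt0// a0.
pose q := expR (lam / 2).
have q0 : 0 < q := expR_gt0 _.
have qq : q * q = a by rewrite -expRD -splitr aE.
have qeta : q < eta.
  by rewrite -ltr_sqr ?nnegrE ?ltW// expr2 qq.
have qN : q * N < r1.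
  by rewrite -ltr_pdivlMr// (lt_le_trans qeta)// ge_min lexx orbT.
have q1 : q < 1 by apply: lt_le_trans eta1.
have aq : a <= q by rewrite -qq ler_piMr// ltW.
(* The bound a ln (1/a) <= 2 sqrt a, obtained from exp x >= 1 + x at x = - ln a / 2. *)
have alam : a * - lam <= 2 * q.
  have := expR_ge1Dx (- (lam / 2)) => h.
  have : a * (- (lam / 2)) <= a * expR (- (lam / 2)) by rewrite ler_wpM2l// ?ltW//; lra.
  have -> : a * expR (- (lam / 2)) = q.
    by rewrite -aE -expRD; congr expR; lra.
  lra.
have apow x : a `^ x = expR (x * lam) by rewrite /powR gt_eqF.
have kq : k * a <= k * q by rewrite ler_wpM2l.
exists (- lam / (2 * (L + 1))), (- lam / D); split.
- by rewrite divr_ge0 ?oppr_ge0 ?(ltW lam0)// mulr_ge0 ?ltW.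
- by rewrite divr_ge0 ?oppr_ge0 ?(ltW lam0)// ltW.
- by rewrite (_ : _ * _ = lam) ?aE//; field; rewrite gt_eqF.
split.
- rewrite apow ler_expR (_ : _ * - D = D / (2 * (L + 1)) * lam); last first.
    by field; rewrite gt_eqF.
  by rewrite ler_wnM2r ?(ltW lam0)// ge_min lexx orbT.
- rewrite apow -{1}aE -expRD ler_expR.
  rewrite (_ : lam + _ = 2^-1 * lam); first by rewrite ler_wnM2r// ltW.
  by field; rewrite gt_eqF.
- rewrite (_ : a * (B * _) = (a * - lam) * (B * (1 / (L + 1)) / 2)); last first.
    by field; rewrite gt_eqF.
  have : (a * - lam) * (B * (1 / (L + 1)) / 2) <= 2 * q * (B * (1 / (L + 1)) / 2).
    by rewrite ler_wpM2r// divr_ge0.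
  have := mulr_ge0 (ltW q0) N2.
  rewrite /N !mulrDr in qN; lra.
- rewrite (_ : a * (B * _) = (a * - lam) * (B * (2 / D) / 2)); last first.
    by field; rewrite gt_eqF.
  have : (a * - lam) * (B * (2 / D) / 2) <= 2 * q * (B * (2 / D) / 2).
    by rewrite ler_wpM2r// divr_ge0.
  have := mulr_ge0 (ltW q0) N1.
  rewrite /N !mulrDr in qN; lra.
Qed.

Unset Implicit Arguments.

Theorem theorem5p3 (R : realType) (n d : nat) :
  exists r0 : nat, forall r : nat, (r0 <= r)%N ->
  forall
    (* unperturbed system *)
    (h0 : 'rV[R]_d -> R) (sg : 'I_n -> bool) (V : 'I_n -> R -> R)
    (H0_smooth : Ck r.+1 setT (rotator_pendulum h0 sg V))
    (V_potential : forall i, pendulum_potential (V i))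
    (* perturbation *)
    (eps0 : R) (eps0_gt0 : 0 < eps0)
    (X1 : phase R n d -> R -> R -> phase R n d)
    (X1_on_M : forall t eps, periodic_on_M (fun z => X1 z t eps))
    (X1_smooth : Ckb r [set w : phase R n d * R * R | `|w.2| < eps0]
                     (fun w => X1 w.1.1 w.1.2 w.2))
    (* extended flow *)
    (Phi : R -> R -> ext_phase R n d -> ext_phase R n d)
    (Phi_flow : forall eps, `|eps| < eps0 ->
       is_flow (ext_field (ham_field (rotator_pendulum h0 sg V)) X1 eps)
               (Phi eps))
    (* normally hyperbolic manifolds *)
    (ell : nat) (ell_gt0 : (0 < ell)%N)
    (c : 'rV[R]_d) (rad : R) (rad_gt0 : 0 < rad)
    (lam_p mu_c mu_m : R) (lam_p_lt0 : lam_p < 0) (mu_m_gt0 : 0 < mu_m)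
    (N : cylinders R n d)
    (N_nhim : persistent_nhim ell eps0 (closed_eball c rad)
                lam_p mu_c mu_m Phi N)
    (* foot points *)
    (Omp Omm : R -> ext_phase R n d -> ext_phase R n d)
    (Omp_foot : forall eps, `|eps| < eps0 ->
       foot_projection (Lam N (closed_eball c rad) eps)
                       (Ws (Phi eps) lam_p) (Omp eps))
    (Omm_foot : forall eps, `|eps| < eps0 ->
       foot_projection (Lam N (closed_eball c rad) eps)
                       (Wu (Phi eps) mu_m) (Omm eps))
    (* homoclinic channels *)
    (Gam : R -> set (ext_phase R n d))
    (Gam_smooth : smooth_family ell (d + d).+1
                    [set eps | 0 < `|eps| < eps0] Gam)
    (Gam_channel : forall eps, 0 < `|eps| < eps0 ->
       homoclinic_channel ell (Phi eps) lam_p mu_m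
         (Lam N (closed_eball c rad) eps) (Omp eps) (Omm eps) (Gam eps))
    (* homoclinic points *)
    (z : R -> ext_phase R n d)
    (z_Gam : forall eps, 0 < `|eps| < eps0 -> Gam eps (z eps))
    (C : R)
    (z_asymp : forall eps, 0 < `|eps| < eps0 ->
       (forall s, 0 <= s ->
          distM (Phi eps s (z eps)) (Phi eps s (Omp eps (z eps)))
          <= C * expR (s * lam_p)) /\
       (forall s, s <= 0 ->
          distM (Phi eps s (z eps)) (Phi eps s (Omm eps (z eps)))
          <= C * expR (s * mu_m)))
    (z0 : ext_phase R n d)
    (z0_hom : (WsL (Phi 0) lam_p (Lam N (closed_eball c rad) 0) `&`
               WuL (Phi 0) mu_m (Lam N (closed_eball c rad) 0)) z0)
    (z_z0 : (fun eps : R => distM (z eps) z0) =O_ (0^') (fun eps : R => eps)),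
  let zp := fun eps => Omp eps (z eps) in
  let zm := fun eps => Omm eps (z eps) in
  let z0pm := Omp 0 z0 in
  let X1I := fun w : ext_phase R n d =>
    lie (fun y => X1 y w.2 0) (@act R n d) w.1 in
  [/\ eqM (Omm 0 z0) z0pm,
      forall eps, 0 < `|eps| < eps0 ->
        scattering_map (Gam eps) (Omp eps) (Omm eps) (zm eps) = zp eps &
      exists rho : R, 0 < rho < 1 /\
        (let integrand := fun s => X1I (Phi 0 s z0pm) - X1I (Phi 0 s z0) in
         vintegrable integrand /\
         (fun eps : R => act (zp eps).1 - act (zm eps).1)
           = (fun eps : R => - (eps *: vintegral integrand))
             +O_ (0^') (fun eps : R => `|eps| `^ (1 + rho))) /\
        (forall H1 : phase R n d -> R -> R -> R,
           (forall t eps, periodic_on_M (fun y => H1 y t eps)) ->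
           Ck r.+1 [set w : phase R n d * R * R | `|w.2| < eps0]
             (fun w => H1 w.1.1 w.1.2 w.2) ->
           (forall y t eps, `|eps| < eps0 ->
              X1 y t eps = ham_field (fun y' => H1 y' t eps) y) ->
           let IH1 := fun w : ext_phase R n d =>
             vpoisson (@act R n d) (fun y => H1 y w.2 0) w.1 in
           let integrand := fun s => IH1 (Phi 0 s z0pm) - IH1 (Phi 0 s z0) in
           vintegrable integrand /\
           (fun eps : R => act (zp eps).1 - act (zm eps).1)
             = (fun eps : R => - (eps *: vintegral integrand))
               +O_ (0^') (fun eps : R => `|eps| `^ (1 + rho)))].
Proof.
(* From [r = 1] on, the Hamiltonian is C^2 and the perturbation C^1 with bounded derivatives, which
   is enough for the Lipschitz bounds. *)
exists 1%N => -[//|r] _ h0 sg V H0s Vp eps0 eps0_gt0 X1 Xper Xs Phi Phif ell _ ctr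
  rad _ lam mu_c mu lam0 mu0 N [embN0 [_ _ [K0 HK0]] _ _ _] Omp Omm fop fom Gam _
  Gamc z zG C zas z0 [z0s z0u] zO zp zm z0pm X1I.
pose X0 := ham_field (rotator_pendulum h0 sg V).
pose I0 := act z0.1.
have V_per i x : V i (x + 1) = V i x by case: (Vp i).
have [r1 r10 [L [B tame]]] := rotator_pendulum_tame I0 V_per H0s Xper Xs.
have L0 := tame_L tame; have B0 := tame_B tame.
have eps00 : `|0 : R| < eps0 by rewrite normr0.
(* One decay rate for both directions of time; [C'] below is likewise a common constant for the
   perturbed and the unperturbed orbits. *)
pose D := Num.min (- lam) mu.
have D0 : 0 < D by rewrite lt_min oppr_gt0 lam0.
have Dlam : D <= - lam by rewrite ge_min lexx.
have Dmu : D <= mu by rewrite ge_min lexx orbT.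
have Lam_base eps y : `|eps| < eps0 -> Lam N (closed_eball ctr rad) eps y ->
    exists (b : base R d) (l' : ext_phase R n d), ext_lattice l' /\
    `|y - l' - (((0, 0), (b.1.1, b.1.2)), b.2 : R)| <= Num.max 0 K0 * `|eps|.
  move=> he [b Db yb]; exists b, (y - emb N eps b); split => //.
  rewrite subKr -embN0; apply: (le_trans (HK0 _ _ he Db)).
  by rewrite ler_wpM2r// le_max lexx orbT.
have orb s eps w : `|eps| < eps0 ->
    orbit_of (ext_field X0 X1 eps) s (fun t => Phi eps (s * t) w).
  move=> he t; have [_ h] := Phif eps he w.
  exact: (@is_derive_scale_time _ _ (fun t => Phi eps t w) s t _ (h _)).
have Phi_0 eps s w : `|eps| < eps0 -> Phi eps (s * 0) w = w.
  by move=> he; rewrite mulr0; have [] := Phif eps he w.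
have [Lp [Cp HCp] _] := fop 0 eps00 z0 z0s.
have [Lm [Cm HCm] _] := fom 0 eps00 z0 z0u.
pose C' := Num.max (Num.max Cp Cm) (Num.max C 0).
have C'0 : 0 <= C' by rewrite !le_max lexx !orbT.
have CpC' : Cp <= C' by rewrite !le_max lexx.
have CmC' : Cm <= C' by rewrite !le_max lexx !orbT.
have CC' : C <= C' by rewrite !le_max lexx !orbT.
have rate a k s : a <= C' -> k <= - D -> 0 <= s ->
    a * expR (s * k) <= C' * expR (s * - D).
  move=> aC kD s0; apply: (@le_trans _ _ (C' * expR (s * k))).
    by rewrite ler_wpM2r ?expR_ge0.
  by rewrite ler_wpM2l// ler_expR ler_wpM2l.
have dist_p eps w y a : a <= C' ->
    (forall s, 0 <= s -> distM (Phi eps s w) (Phi eps s y) <= a * expR (s * lam)) ->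
    forall s, 0 <= s -> distM (Phi eps (1 * s) w) (Phi eps (1 * s) y) <=
      C' * expR (s * - D).
  move=> aC h s s0; rewrite mul1r; apply: (le_trans (h _ s0)); apply: rate => //.
  lra.
have dist_m eps w y a : a <= C' ->
    (forall s, s <= 0 -> distM (Phi eps s w) (Phi eps s y) <= a * expR (s * mu)) ->
    forall s, 0 <= s -> distM (Phi eps (-1 * s) w) (Phi eps (-1 * s) y) <=
      C' * expR (s * - D).
  move=> aC h s s0; rewrite mulN1r; apply: (le_trans (h _ _)); first by rewrite oppr_le0.
  by rewrite mulNr -mulrN; apply: rate => //; rewrite lerN2.
have norm1 : `|1 : R| = 1 by rewrite normr1.
have normN1 : `|-1 : R| = 1 by rewrite normrN1.
have c0 : - D < 0 by rewrite oppr_lt0.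
(* At eps = 0 all terms of [foot_close] but the tail at [T] vanish. Since [T] is arbitrary, [y] is
   the projection of [z0] modulo the lattice, in either direction of time. *)
have foot0 s y : `|s| = 1 -> Lam N (closed_eball ctr rad) 0 y ->
    (forall t, 0 <= t -> distM (Phi 0 (s * t) z0) (Phi 0 (s * t) y) <=
      C' * expR (t * - D)) ->
    eqM y (cylinder_proj z0).
  move=> s1 Ly dzy; apply: eqM_of_distM => e e0.
  have [b [l' [hl' hb]]] := Lam_base 0 y eps00 Ly.
  have [T T0 hT] := exp_small (C' + 1) 0 c0 (divr_gt0 e0 (ltr0n _ 2)).
  have := @foot_close _ _ _ _ _ _ _ _ _ _ tame s s1 0 eps00 (- D) C' c0
    (fun t => Phi 0 (s * t) z0) (fun t => Phi 0 (s * t) y)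
    (orb _ _ _ eps00) (orb _ _ _ eps00) dzy T T0 _ (Num.max 0 K0) b l' hl'.
  rewrite !Phi_0// normr0 !mul0r !mulr0 addr0 subrr normr0 add0r => /(_ r10).
  rewrite normr0 mulr0 in hb => /(_ hb)[l hl hd].
  apply: le_lt_trans (distM_le _ _ hl) _; apply: (le_lt_trans hd).
  by apply: (le_lt_trans hT); lra.
have eqp : eqM z0pm (cylinder_proj z0).
  by apply: (foot0 1) => //; exact: dist_p HCp.
have eqm : eqM (Omm 0 z0) (cylinder_proj z0).
  by apply: (foot0 (-1)) => //; exact: dist_m HCm.
have eqpm : eqM (Omm 0 z0) z0pm.
  by rewrite /eqM -(subrKA (cylinder_proj z0)) -[_ - z0pm]opprB; exact: ext_latticeB.
have act_pm : act z0pm.1 = I0.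
  by case: eqp => -[_ /subr0_eq].
have act_m : act (Omm 0 z0).1 = I0.
  by case: eqm => -[_ /subr0_eq].
have dist0_p s : 0 <= s -> distM (Phi 0 (1 * s) z0) (Phi 0 (1 * s) z0pm) <=
    C' * expR (s * - D).
  exact: dist_p HCp _.
(* The decay is known for [Omm 0 z0]. That point is a lattice translate of [z0pm], and
   [orbit_compare] with zero initial error shows that the translation persists along the orbits. *)
have dist0_m s : 0 <= s -> distM (Phi 0 (-1 * s) z0) (Phi 0 (-1 * s) z0pm) <=
    C' * expR (s * - D).
  move=> s0.
  have := @orbit_compare _ _ _ _ _ _ _ _ _ _ tame (-1) normN1 0
    (fun t => Phi 0 (-1 * t) (Omm 0 z0)) (fun t => Phi 0 (-1 * t) z0pm) _ 0 s eps00 s0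
    (orb _ _ _ eps00) (orb _ _ _ eps00) eqpm (lexx 0).
  rewrite !Phi_0// subrr normr0 lexx act_m act_pm subrr !normr0 !mul0r !addr0 mul0r.
  rewrite normr_le0 => /(_ isT r10 r10) /eqP/subr0_eq.
  move/eqP; rewrite subr_eq => /eqP hPhi.
  rewrite -(distM_shift _ _ eqpm) addrC -hPhi.
  exact: dist_m HCm _ s0.
have X1IE w : X1I w = act (X1 w.1 w.2 0) by rewrite /X1I lie_act.
pose G s := X1I (Phi 0 s z0pm) - X1I (Phi 0 s z0).
have Gle s : `|G s| <= envelope (L * C') D s.
  rewrite /G !X1IE distrC /envelope.
  apply: (le_trans (norm_act (X1 _ _ 0 - X1 _ _ 0))).
  apply: (le_trans (X1_lip_distM tame _ _ eps00)).
  rewrite -mulrA ler_wpM2l// [- D * _]mulrC; have [s0|/ltW s0] := leP 0 s.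
    by have := dist0_p s s0; rewrite mul1r ger0_norm.
  have := dist0_m (- s); rewrite oppr_ge0 mulN1r opprK => /(_ s0).
  by rewrite ler0_norm.
have GjE j s : `|G s 0 j| <= envelope (L * C') D s.
  exact: le_trans (rV_norm_ge _ _) (Gle s).
have X1c w : continuous (fun s => X1 (Phi 0 s w).1 (Phi 0 s w).2 0).
  move=> s.
  have [_ [dX _]] := Xs.
  have dXs := dX (Phi 0 s w, 0) eps00.
  apply: (@continuous_comp _ _ _ (fun s => (Phi 0 s w, 0 : R))
    (fun w => X1 w.1.1 w.1.2 w.2)); last exact: differentiable_continuous.
  have [_ /(_ s) [/derivable1_diffP dPhi _]] := Phif 0 eps00 w.
  apply: differentiable_continuous.
  exact: (@differentiable_pair _ _ _ _ (fun s => Phi 0 s w) (fun _ => 0 : R)).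
pose a w j s := act (X1 (Phi 0 s w).1 (Phi 0 s w).2 0) 0 j.
have ac w j : continuous (a w j).
  move=> s; apply/cvgrPdist_lt => e e0.
  have /cvgrPdist_lt/(_ e e0) := X1c w s.
  apply: filterS => t ht; apply: le_lt_trans ht.
  apply: le_trans (norm_act _); apply: le_trans (rV_norm_ge _ j).
  by rewrite -[act (_ - _)]/(act _ - act _) !mxE.
have GE j : (fun s => G s 0 j) = (fun s => a z0pm j s - a z0 j s).
  by apply/funext => t; rewrite /G !X1IE !mxE.
have Gc j : continuous (fun s => G s 0 j).
  by rewrite GE => s; apply: cvgB; exact: ac.
have LC0 : 0 <= L * C' by rewrite mulr_ge0.
have [P HP] := choice (fun j => decay_primitive LC0 D0 (Gc j) (GjE j)).
pose A s : 'rV[R]_d := \row_j P j s.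
have dA s : is_derive s (1 : R) A (G s).
  by apply: is_derive_row => j; case: (HP j).
have intG : vintegrable G.
  by move=> j; exact: integrable_decay LC0 D0 _ (Gc j) (GjE j).
have vint T : 0 <= T ->
    `|vintegral G - (A T - A (- T))| <= 2 * (L * C' / D * expR (T * - D)).
  move=> T0; apply: rV_norm_le => [|j].
    by rewrite !mulr_ge0 ?expR_ge0// invr_ge0 ltW.
  by have [_ /(_ T T0)] := HP j; rewrite !mxE [T * - D]mulrC.
split => // [eps he|].
  have [_ _ _ _ [_ [_ _ [g _ gK]]]] := Gamc eps he.
  rewrite /scattering_map.
  (* [z eps] witnesses that the default 0 is not taken, and the left inverse [g] of [Omm eps] on the
     channel identifies the chosen preimage with [z eps]. *)
  have [Gx Ex] := xgetPex 0 (ex_intro [set x | Gam eps x /\ Omm eps x = zm eps]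
    (z eps) (conj (zG eps he) erefl)).
  by congr (Omp eps _); rewrite -[LHS]gK// Ex gK//; exact: zG.
pose K1 := L * C' / D.
have K10 : 0 <= K1 by rewrite divr_ge0// ltW.
have /eqOP[k0 [_ Hk0]] := zO.
(* One unit is needed to exceed the threshold [k0] of the O bound, the other to make the bound
   strict, so that an actual lattice vector attains it. *)
pose kz := Num.max 0 k0 + 2.
have kz0 : 0 <= kz by rewrite addr_ge0// le_max lexx.
have k2 : 0 <= kz + 2 * K1 by rewrite addr_ge0// mulr_ge0.
have [rho rho01 [del del0 Hdel]] := time_scales D0 L0 k2 B0 r10.
pose K0' := Num.max 0 K0.
have K0'0 : 0 <= K0' by rewrite le_max lexx.
pose M := K0' + K1 + L * (K1 + C') / D + (C' + 1) + kz.
have M0 : 0 <= M.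
  have : 0 <= L * (K1 + C') / D by rewrite divr_ge0 ?(ltW D0)// mulr_ge0// addr_ge0.
  by rewrite /M; lra.
(* Two half expansions plus the two tails of the truncated integral. *)
pose Kf := 2 * (K1 + 2 * (M + B + 1)) + 2 * K1.
(* The backward half runs along the orbits at time -t, where the integrand is [G] at -t and has the
   primitive -A(-t). *)
have A0N s : is_derive s (1 : R) (fun t => - A (-1 * t)) (G (-1 * s)).
  have h := @is_derive_scale_time _ _ A (-1) s _ (dA _).
  by apply: is_derive_eq; rewrite scaleN1r opprK.
have main : \forall eps \near 0^',
    `|act (zp eps).1 - act (zm eps).1 - - (eps *: vintegral G)| <=
    Kf * `| `|eps| `^ (1 + rho)|.
  have Hk : \forall eps \near 0^', `|distM (z eps) z0| <= (Num.max 0 k0 + 1) * `|eps|.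
    by apply: Hk0; rewrite (le_lt_trans (y := Num.max 0 k0)) ?ltrDl// le_max lexx orbT.
  near=> eps.
  have e_neq0 : eps != 0 by near: eps; exact: nbhs_dnbhs_neq.
  have e0 : 0 < `|eps| by rewrite normr_gt0.
  have he : `|eps| < eps0 by near: eps; exact: dnbhs0_lt.
  have hde : `|eps| < del by near: eps; exact: dnbhs0_lt.
  have hz : `|distM (z eps) z0| <= (Num.max 0 k0 + 1) * `|eps| by near: eps.
  have he' : 0 < `|eps| < eps0 by rewrite e0.
  have [T [T1 [T0 T10 ET1 [ET ELT near1 near2]]]] : exists T T1,
      [/\ 0 <= T, 0 <= T1, expR (T1 * - D) <= `|eps| &
      [/\ expR (T * - D) <= `|eps| `^ rho,
        `|eps| * expR ((L + 1) * T) <= `|eps| `^ rho,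
        (kz + 2 * K1) * `|eps| + `|eps| * (B * T) < r1 &
        (kz + 2 * K1) * `|eps| + `|eps| * (B * T1) < r1]].
    by apply: Hdel; rewrite e0.
  have [lx hlx hx] : exists2 l, ext_lattice l & `|z eps - z0 - l| <= kz * `|eps|.
    have [|l hl hd] := @distM_adherent R n d (z eps) z0 (kz * `|eps|).
      apply: le_lt_trans (le_trans (ler_norm _) hz) _.
      by rewrite ltr_pM2r// /kz ltrD2l ltr1n.
    by exists l => //; exact: ltW.
  have [GW _ _ _ _] := Gamc eps he'.
  have [Ws_z Wu_z] := GW _ (zG eps he').
  have [Lzp _ _] := fop eps he _ Ws_z.
  have [Lzm _ _] := fom eps he _ Wu_z.
  have [zas_p zas_m] := zas eps he'.
  have [bp [lp [hlp hbp]]] := Lam_base eps _ he Lzp.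
  have [bm [lm [hlm hbm]]] := Lam_base eps _ he Lzm.
  have Hp := @half_expansion R n d X0 X1 eps0 I0 r1 L B 1 eps D C' T T1 kz K0'
    (fun t => Phi eps (1 * t) (z eps)) (fun t => Phi eps (1 * t) (zp eps))
    (fun t => Phi 0 (1 * t) z0) (fun t => Phi 0 (1 * t) z0pm) lx lp bp A
    tame norm1 he D0 T0 T10 K0'0 kz0 (orb _ _ _ he) (orb _ _ _ he)
    (orb _ _ _ eps00) (orb _ _ _ eps00) (dist_p _ _ _ _ CC' zas_p) hlx.
  have Hm := @half_expansion R n d X0 X1 eps0 I0 r1 L B (-1) eps D C' T T1 kz K0'
    (fun t => Phi eps (-1 * t) (z eps)) (fun t => Phi eps (-1 * t) (zm eps))
    (fun t => Phi 0 (-1 * t) z0) (fun t => Phi 0 (-1 * t) z0pm) lx lm bm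
    (fun t => - A (-1 * t))
    tame normN1 he D0 T0 T10 K0'0 kz0 (orb _ _ _ he) (orb _ _ _ he)
    (orb _ _ _ eps00) (orb _ _ _ eps00) (dist_m _ _ _ _ CC' zas_m) hlx.
  rewrite !Phi_0// in Hp Hm.
  have {}Hp := Hp hx hlp hbp eqp erefl ET1 near1 near2.
  have {}Hm := Hm hx hlm hbm eqp erefl ET1 near1 near2.
  have {}Hp : `|act (zp eps).1 - act (z eps).1 + (1 * eps) *: (A T - A 0)| <=
      `|eps| * (K1 * expR (T * - D) + 2 * ((M + B + 1) * `|eps|) * expR ((L + 1) * T)).
    by apply: Hp => s; have := dA s; rewrite /G !X1IE mul1r.
  have {}Hm : `|act (zm eps).1 - act (z eps).1 + (-1 * eps) *: (- A (-1 * T) - - A (-1 * 0))| <=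
      `|eps| * (K1 * expR (T * - D) + 2 * ((M + B + 1) * `|eps|) * expR ((L + 1) * T)).
    by apply: Hm => s; have := A0N s; rewrite /G !X1IE.
  rewrite mul1r in Hp; rewrite !mulN1r oppr0 in Hm.
  have Hv := vint T T0.
  set p := act (zp eps).1 in Hp *; set m := act (zm eps).1 in Hm *.
  set q := act (z eps).1 in Hp Hm; set Q := `|eps| * _ in Hp Hm.
  (* Subtracting the halves cancels [q], the action of the homoclinic point, and [A 0]; the last
     term is the truncation error of the integral. *)
  have -> : p - m - - (eps *: vintegral G) =
      (p - q + eps *: (A T - A 0)) - (m - q + (- eps) *: (- A (- T) - - A 0))
      + eps *: (vintegral G - (A T - A (- T))).
    by apply/rowP => j; rewrite !mxE; ring.
  apply: (le_trans (ler_normD _ _)).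
  have h1 := ler_normB (p - q + eps *: (A T - A 0)) (m - q + (- eps) *: (- A (- T) - - A 0)).
  have h2 : `|eps *: (vintegral G - (A T - A (- T)))| <= `|eps| * (2 * (K1 * expR (T * - D))).
    by rewrite normrZ ler_wpM2l.
  have powE : `| `|eps| `^ (1 + rho)| = `|eps| * `|eps| `^ rho.
    have hne : (1 + rho == 0) ==> (`|eps| != 0) by rewrite (gt_eqF e0) implybT.
    by rewrite ger0_norm ?powR_ge0// (powRD hne) powRr1.
  have h3 : Q <= `|eps| * ((K1 + 2 * (M + B + 1)) * `|eps| `^ rho).
    have MB : 0 <= 2 * (M + B + 1) by rewrite mulr_ge0// (addr_ge0 (addr_ge0 M0 B0) ler01).
    have hq : 2 * ((M + B + 1) * `|eps|) * expR ((L + 1) * T) =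
        2 * (M + B + 1) * (`|eps| * expR ((L + 1) * T)) by ring.
    rewrite /Q hq ler_wpM2l// [leRHS]mulrDl.
    by apply: lerD; rewrite ler_wpM2l.
  have h4 : `|eps| * (2 * (K1 * expR (T * - D))) <= `|eps| * (2 * K1 * `|eps| `^ rho).
    by rewrite ler_wpM2l// -mulrA ler_wpM2l// ler_wpM2l.
  have -> : Kf * `| `|eps| `^ (1 + rho)| =
      2 * (`|eps| * ((K1 + 2 * (M + B + 1)) * `|eps| `^ rho)) +
      `|eps| * (2 * K1 * `|eps| `^ rho).
    by rewrite powE /Kf; ring.
  apply: lerD; last exact: le_trans h2 h4.
  apply: (le_trans h1); rewrite mulr_natl mulr2n.
  exact: lerD (le_trans Hp h3) (le_trans Hm h3).
have mainO : (fun eps : R => act (zp eps).1 - act (zm eps).1)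
    = (fun eps : R => - (eps *: vintegral G))
      +O_ (0^') (fun eps : R => `|eps| `^ (1 + rho)).
  apply/eqaddOP; near=> k; move: main; apply: filterS => eps /= /le_trans; apply.
  rewrite ler_wpM2r//; near: k; exact: nbhs_pinfty_ge.
exists rho; split; first exact: rho01.
split; first exact: (conj intG mainO).
move=> H1 _ _ HX IH1 integrand.
(* Only the values at eps = 0 enter, where the perturbation is the Hamiltonian field of [H1]. *)
have -> : integrand = G.
  apply/funext => s; rewrite /integrand /IH1 !vpoisson_act /G !X1IE.
  by rewrite -(HX _ _ 0 eps00) -(HX _ _ 0 eps00).
exact: (conj intG mainO).
Unshelve. all: by end_near.
Qed.
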